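(* Let $\mathcal{X}\subseteq\mathbb{R}^d$ be a nonempty closed convex bounded set, let $R=\max_{x,y\in\mathcal{X}}\|x-y\|$ and $R_\infty\ge\max_{x,y\in\mathcal{X}}\|x-y\|_\infty$. Let $B=\mathrm{diag}(\beta_1,\dots,\beta_d)$ with $\beta_1,\dots,\beta_d>0$ (unknown to the algorithm), and let $F\colon\mathcal{X}\to\mathbb{R}^d$ be $1$-cocoercive with respect to $\|\cdot\|_B$, i.e. $\langle F(x)-F(y),x-y\rangle\ge\|F(x)-F(y)\|_{B^{-1}}^2$ for all $x,y\in\mathcal{X}$, accessed via a stochastic oracle with variance parameter $\sigma^2$. Run Algorithm AdaPEG-Vector (described in the context) with $\gamma_0\ge0$ and $\eta=R_\infty$, and let $\bar x_T$ be its output. Then \[\mathbb{E}[\mathrm{Err}(\bar x_T)]\le O\left(\frac{(\mathrm{tr}(B)+\gamma_0d)R_\infty^2}{T}+\frac{(\sqrt dR_\infty+R)\sigma}{\sqrt T}\right).\]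
   Context: $\|\cdot\|$ is the Euclidean norm; for a positive semidefinite diagonal matrix $A$, $\|x\|_A^2=x^\top Ax$; $A_i$ denotes the $i$-th diagonal entry and $v_i$ the $i$-th coordinate of $v$. Stochastic oracle: queried at $x_t$ it returns a random $\widehat{F(x_t)}$ with $\mathbb{E}[\widehat{F(x_t)}\mid x_1,\dots,x_t]=F(x_t)$ and $\mathbb{E}\|\widehat{F(x_t)}-F(x_t)\|^2\le\sigma^2$. $\mathrm{Err}(x)=\sup_{y\in\mathcal{X}}\langle F(y),x-y\rangle$. Algorithm AdaPEG-Vector: $x_0=z_0\in\mathcal{X}$, $D_0=\gamma_0I$, $\eta>0$. For $t=1,\dots,T$: $x_t=\arg\min_{u\in\mathcal{X}}\{\langle\widehat{F(x_{t-1})},u\rangle+\tfrac12\|u-z_{t-1}\|_{D_{t-1}}^2\}$; $D_t$ diagonal with $D_{t,i}=\frac1\eta\sqrt{\eta^2D_{0,i}^2+\sum_{s=1}^t\big((\widehat{F(x_s)})_i-(\widehat{F(x_{s-1})})_i\big)^2}$; $z_t=\arg\min_{u\in\mathcal{X}}\{\langle\widehat{F(x_t)},u\rangle+\tfrac12\|u-z_{t-1}\|_{D_{t-1}}^2+\tfrac12\|u-x_t\|_{D_t-D_{t-1}}^2\}$. Output $\bar x_T=\frac1T\sum_{t=1}^Tx_t$. $O(\cdot)$ hides absolute constants. *)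

(* Defs.v *)
From HB Require Import structures.
From mathcomp Require Import all_boot all_order all_algebra.
From mathcomp Require Import all_classical all_reals all_analysis.
Set Implicit Arguments. Unset Strict Implicit. Unset Printing Implicit Defensive.
Import Order.TTheory GRing.Theory Num.Theory.
Import numFieldNormedType.Exports.
Local Open Scope classical_set_scope.
Local Open Scope ring_scope.

(* Vectors of R^d are row vectors 'rV[R]_d; coordinate i of v is v ord0 i.
   Diagonal matrices are represented by their diagonal (a row vector). *)

Definition vcoord {R : Type} {d : nat} (v : 'rV[R]_d) (i : 'I_d) : R := v ord0 i.

Definition dotp {R : realType} {d : nat} (u v : 'rV[R]_d) : R :=
  \sum_(i < d) vcoord u i * vcoord v i.
Definition enorm {R : realType} {d : nat} (u : 'rV[R]_d) : R := Num.sqrt (dotp u u).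
Definition infnorm {R : realType} {d : nat} (u : 'rV[R]_d) : R :=
  \big[Num.max/0]_(i < d) `|vcoord u i|.
(* ||u||_A^2 = u^T A u for the diagonal matrix A = diag(a) *)
Definition wnorm2 {R : realType} {d : nat} (a u : 'rV[R]_d) : R :=
  \sum_(i < d) vcoord a i * vcoord u i ^+ 2.
Definition vinv {R : realType} {d : nat} (a : 'rV[R]_d) : 'rV[R]_d :=
  \row_(i < d) (vcoord a i)^-1.
Definition trace_diag {R : realType} {d : nat} (a : 'rV[R]_d) : R :=
  \sum_(i < d) vcoord a i.

Definition is_argmin {R : realType} {d : nat} (X : set 'rV[R]_d)
  (f : 'rV[R]_d -> R) (u : 'rV[R]_d) : Prop :=
  X u /\ forall v, X v -> f u <= f v.

Definition Err {R : realType} {d : nat} (X : set 'rV[R]_d)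
  (F : 'rV[R]_d -> 'rV[R]_d) (x : 'rV[R]_d) : R :=
  sup [set dotp (F y) (x - y) | y in X].

(* AdaPEG-Vector step sizes: D_{t,i} = (1/eta) sqrt(eta^2 D_{0,i}^2 +
   sum_{s=1}^t (G_s i - G_{s-1} i)^2), with D_0 = gamma0 I and G_s = \hat F(x_s). *)
Definition Dstep {R : realType} {d : nat} (gamma0 eta : R)
  (G : nat -> 'rV[R]_d) (t : nat) : 'rV[R]_d :=
  \row_(i < d) (eta^-1 * Num.sqrt (eta ^+ 2 * gamma0 ^+ 2 +
      \sum_(1 <= s < t.+1) (vcoord (G s) i - vcoord (G s.-1) i) ^+ 2)).

Definition hist_gen {d0 : measure_display} {Omega : measurableType d0}
  {R : realType} {d : nat} (x : nat -> Omega -> 'rV[R]_d) (t : nat) : set (set Omega) :=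
  [set A | exists s, exists i : 'I_d, exists B : set R,
     [/\ (1 <= s <= t)%N, measurable B & A = (fun w => vcoord (x s w) i) @^-1` B]].

Definition hist_sigma {d0 : measure_display} {Omega : measurableType d0}
  {R : realType} {d : nat} (x : nat -> Omega -> 'rV[R]_d) (t : nat) : set (set Omega) :=
  <<s hist_gen x t >>.

(* Main.v *)
(** The oracle is unbiased only given the past iterates, so earlier noise stays
    hidden and the noise partial sums are not a martingale for the available
    filtration.  Instead, the comparator [y] attaining [Err] (up to a finite net)
    is replaced at time [t] by [y_t = E[y | x_0, ..., x_t]], the iterates being
    quantized so that all conditional expectations are finite sums.  Since [y_t]
    is known when the oracle is queried, [E sum <F(x_t), x_t - y>] equals
    [E sum <G_t, x_t - y_t>].  The regret of the algorithm against the moving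
    comparator is at most [sum_i D_(T,i) Y_i], where [Y_i] is [5 eta^2] plus a
    martingale transform of [y_t] and its running maximum; Doob's inequality gives
    [E Y_i^2 <= 315 eta^4].  The part of [D_T] coming from [F] is absorbed by
    cocoercivity, the part coming from the noise by Cauchy-Schwarz. *)

Require Import Defs.
From HB Require Import structures.
From mathcomp Require Import all_boot all_order all_algebra.
From mathcomp Require Import all_classical all_reals all_analysis.
From mathcomp Require Import measurable_realfun ring lra.
Set Implicit Arguments.
Unset Strict Implicit.
Unset Printing Implicit Defensive.
Import Order.TTheory GRing.Theory Num.Theory.
Import numFieldNormedType.Exports.
Local Open Scope classical_set_scope.
Local Open Scope ring_scope.

(** * Finite martingales *)

(** A moving comparator normally costs its path length, of order [T]. Here the cost stays of order
    [eta^2] per coordinate because the comparator is a bounded martingale: its squared increments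
    have total mean at most [eta^2], and the first-order terms form a martingale transform. The
    weights [D_t] in front of these terms depend on the noise and are correlated with the
    comparator, so means cannot be taken term by term. Abel summation along each path pulls out the
    final [D_T], which is where the running maximum comes from, and Young's inequality then
    separates [D_T] from [Y], so that only the second moment of [Y] is needed. The Young weight
    [lam] of the noise part is a parameter of the analysis alone and stays free until the end, where
    it is optimised; the algorithm does not know [sigma]. *)

Fixpoint runmax (R : realFieldType) (u : nat -> R) (n : nat) : R :=
  if n is n'.+1 then Num.max (runmax u n') (u n) else u 0%N.

Lemma le_runmax (R : realFieldType) (u : nat -> R) (n s : nat) :
  (s <= n)%N -> u s <= runmax u n.
Proof.
elim: n => [|n IH] /=; first by rewrite leqn0 => /eqP ->.
rewrite leq_eqVlt => /predU1P[->|]; first by rewrite le_max lexx orbT.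
by rewrite ltnS => /IH us; rewrite le_max us.
Qed.

(** Doob's maximal inequality before taking means: the sum is a martingale transform, which vanishes
    in expectation. [key] is a summation by parts using that [runmax] moves only to the current
    value of [u]; the rest is the square of [runmax u n - 2 * u n]. *)
Lemma doob_pathwise (R : realFieldType) (u : nat -> R) (n : nat) :
  runmax u n ^+ 2 <=
    4 * u n ^+ 2 - 4 * \sum_(s < n) runmax u s * (u s.+1 - u s).
Proof.
have key : 2 * \sum_(s < n) runmax u s * (u s.+1 - u s) <=
    2 * runmax u n * u n - runmax u n ^+ 2.
  elim: n => [|n IH] /=; first by rewrite big_ord0; nra.
  rewrite big_ord_recr /=.
  set s := \sum_(i < n) _ in IH *.
  by case: (leP (u n.+1) (runmax u n)) => h; nra.
set s := \sum_(i < n) _ in key *.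
have := sqr_ge0 (runmax u n - 2 * u n).
rewrite sqrrB; move: (runmax u n) (u n) key => a b; nra.
Qed.

Definition fexp (R : realFieldType) (S : finType) (p f : S -> R) : R :=
  \sum_a p a * f a.

(** Conditional expectation given the partition into classes of [r]; on a class of mass zero the
    division makes it 0. *)
Definition cexp (R : realFieldType) (S : finType) (p : S -> R) (r : rel S)
  (f : S -> R) (a : S) : R :=
  (\sum_(b | r a b) p b * f b) / (\sum_(b | r a b) p b).

Definition adapted (R : realFieldType) (S : finType) (r : rel S) (f : S -> R) :=
  forall a b, r a b -> f a = f b.

Lemma fexpD (R : realFieldType) (S : finType) (p f g : S -> R) :
  fexp p (fun a => f a + g a) = fexp p f + fexp p g.
Proof. by rewrite /fexp -big_split; apply: eq_bigr => a _; rewrite mulrDr. Qed.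

Lemma fexpZ (R : realFieldType) (S : finType) (p f : S -> R) (k : R) :
  fexp p (fun a => k * f a) = k * fexp p f.
Proof. by rewrite /fexp mulr_sumr; apply: eq_bigr => a _; rewrite mulrCA. Qed.

Lemma fexp_sum (R : realFieldType) (S : finType) (p : S -> R) (n : nat)
    (f : 'I_n -> S -> R) :
  fexp p (fun a => \sum_(i < n) f i a) = \sum_(i < n) fexp p (f i).
Proof.
rewrite /fexp exchange_big /=; apply: eq_bigr => a _.
by rewrite mulr_sumr.
Qed.

Lemma ler_fexp (R : realFieldType) (S : finType) (p f g : S -> R) :
  (forall a, 0 <= p a) -> (forall a, f a <= g a) -> fexp p f <= fexp p g.
Proof. by move=> p0 fg; apply: ler_sum => a _; rewrite ler_wpM2l. Qed.

Lemma cexp_adapted (R : realFieldType) (S : finType) (p : S -> R) (r : rel S)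
    (f : S -> R) : equivalence_rel r -> adapted r (cexp p r f).
Proof.
move=> er a b rab; rewrite /cexp.
have rE c : r a c = r b c by have [_ ->] := er a b c.
by congr (_ / _); apply: eq_bigl => c.
Qed.

Lemma equivalence_rel_sym (S : Type) (r : rel S) :
  equivalence_rel r -> symmetric r.
Proof.
move=> er a b; have refl c : r c c by have [] := er c c c.
apply/idP/idP => [rab|rba].
- by have [_ /(_ rab) <-] := er a b a.
- by have [_ /(_ rba) <-] := er b a b.
Qed.

(** As a double sum over equivalent pairs, the sum over [a] cancels the normalisation [w], since [h]
    and [w] are constant on classes. *)
Lemma fexp_cexp (R : realFieldType) (S : finType) (p : S -> R) (r : rel S)
    (h f : S -> R) :
  (forall a, 0 <= p a) -> equivalence_rel r -> adapted r h ->
  fexp p (fun a => h a * cexp p r f a) = fexp p (fun a => h a * f a).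
Proof.
move=> p0 er ah; rewrite /fexp.
pose w a := \sum_(b | r a b) p b.
have rC := equivalence_rel_sym er.
have rE a b c : r a b -> r a c = r b c by have [_] := er a b c.
transitivity (\sum_a \sum_(b | r a b) p b * f b * (p a * h a / w a)).
  apply: eq_bigr => a _; rewrite -mulr_suml /cexp -/(w a).
  by rewrite [RHS]mulrC -!mulrA; do 2 congr (_ * _); rewrite mulrC.
rewrite (exchange_big_dep xpredT)//=; apply: eq_bigr => b _.
rewrite -mulr_sumr.
have -> : \sum_(a | r a b) p a * h a / w a = \sum_(a | r b a) p a * (h b / w b).
  rewrite (eq_bigl (r b)); last by move=> a; rewrite rC.
  apply: eq_bigr => a rba; rewrite -mulrA (ah _ _ rba); congr (_ * (_ / _)).
  by apply: eq_bigl => c; rewrite (rE _ _ _ rba).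
rewrite -mulr_suml -/(w b); have [wb0|wb0] := eqVneq (w b) 0; last first.
  by field.
(* On a null class nothing cancels, but there [p b] itself vanishes. *)
suff -> : p b = 0 by rewrite !mul0r.
apply/eqP; rewrite eq_le p0 andbT -wb0 /w (bigD1 b) /=; last first.
  by have [] := er b b b.
by rewrite lerDl sumr_ge0.
Qed.

Lemma cexp_le (R : realFieldType) (S : finType) (p : S -> R) (r : rel S)
    (f : S -> R) (B : R) : (forall a, 0 <= p a) ->
  (forall a, `|f a| <= B) -> forall a, `|cexp p r f a| <= B.
Proof.
move=> p0 fB a; have B0 : 0 <= B by apply: le_trans (fB a).
rewrite /cexp normrM normfV.
have w0 : 0 <= \sum_(b | r a b) p b by apply: sumr_ge0.
rewrite (ger0_norm w0).
have [->|wn0] := eqVneq (\sum_(b | r a b) p b) 0; first by rewrite invr0 mulr0.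
rewrite ler_pdivrMr ?lt0r ?wn0// mulr_sumr.
apply: le_trans (ler_norm_sum _ _ _) _; apply: ler_sum => b _.
by rewrite normrM (ger0_norm (p0 b)) mulrC ler_wpM2r.
Qed.

Definition mtransf (R : realFieldType) (S : finType) (h c : nat -> S -> R)
  (n : nat) (a : S) : R := \sum_(s < n) h s a * (c s.+1 a - c s a).

Lemma mtransfS (R : realFieldType) (S : finType) (h c : nat -> S -> R) n a :
  mtransf h c n.+1 a = mtransf h c n a + h n a * (c n.+1 a - c n a).
Proof. by rewrite /mtransf big_ord_recr. Qed.

(** The increments of the closed martingale [cexp p (r t) f] are orthogonal to everything adapted
    ([orth]), so squares add up: the quadratic variation has mean at most [B ^+ 2], and Doob adds
    the factor 4. The maximum is that of [- m] because the regret bound needs a lower bound on the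
    transform. *)
Lemma mtransf_bound (R : realFieldType) (S : finType) (p : S -> R)
    (r : nat -> rel S) (f : S -> R) (h : nat -> S -> R) (B H : R) (n : nat) :
  (forall a, 0 <= p a) -> \sum_a p a = 1 ->
  (forall t, equivalence_rel (r t)) ->
  (forall t a b, r t.+1 a b -> r t a b) ->
  (forall t, adapted (r t) (h t)) ->
  (forall a, `|f a| <= B) -> (forall t a, `|h t a| <= H) ->
  let m := mtransf h (fun t => cexp p (r t) f) in
  fexp p (fun a => m n a ^+ 2) <= H ^+ 2 * B ^+ 2 /\
  fexp p (fun a => runmax (fun s => - m s a) n ^+ 2) <= 4 * (H ^+ 2 * B ^+ 2).
Proof.
move=> p0 p1 er rS ah fB hH.
set c := fun t => cexp p (r t) f; move=> m.
have rle s t a b : (s <= t)%N -> r t a b -> r s a b.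
  move=> st; rewrite -(subnK st); elim: (t - s)%N => [//|k IH] h1.
  by apply: IH; apply: rS.
have ac s t : (s <= t)%N -> adapted (r t) (c s).
  by move=> st a b rab; apply: (cexp_adapted _ _ (er s)); apply: rle rab.
have orth t g : adapted (r t) g ->
    fexp p (fun a => g a * (c t.+1 a - c t a)) = 0.
  move=> ag.
  have agS : adapted (r t.+1) g by move=> a b /rS; apply: ag.
  have -> : fexp p (fun a => g a * (c t.+1 a - c t a)) =
      fexp p (fun a => g a * c t.+1 a) + -1 * fexp p (fun a => g a * c t a).
    by rewrite -fexpZ -fexpD; apply: eq_bigr => a _; ring.
  by rewrite /c !fexp_cexp//; ring.
have am s t : (s <= t)%N -> adapted (r t) (m s).
  move=> st a b rab; apply: eq_bigr => k _.
  have kt : (k < t)%N by rewrite (leq_trans (ltn_ord k)).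
  rewrite (ac k.+1 t kt a b rab) (ac k t (ltnW kt) a b rab).
  by rewrite (ah k a b (rle _ _ _ _ (ltnW kt) rab)).
have qv k : fexp p (fun a => \sum_(s < k) (c s.+1 a - c s a) ^+ 2) <= B ^+ 2.
  apply: (@le_trans _ _ (fexp p (fun a => c k a ^+ 2))).
    elim: k => [|k IH].
      apply: ler_fexp => // a; by rewrite big_ord0 sqr_ge0.
    have -> : fexp p (fun a => \sum_(s < k.+1) (c s.+1 a - c s a) ^+ 2) =
        fexp p (fun a => \sum_(s < k) (c s.+1 a - c s a) ^+ 2) +
        fexp p (fun a => (c k.+1 a - c k a) ^+ 2).
      by rewrite -fexpD; apply: eq_bigr => a _; rewrite big_ord_recr.
    have -> : fexp p (fun a => c k.+1 a ^+ 2) =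
       fexp p (fun a => c k a ^+ 2) + fexp p (fun a => (c k.+1 a - c k a) ^+ 2)
       + 2 * fexp p (fun a => c k a * (c k.+1 a - c k a)).
      by rewrite -fexpZ -!fexpD; apply: eq_bigr => a _; congr (_ * _); ring.
    by rewrite (orth k (c k) (ac k k (leqnn k))) mulr0 addr0 lerD2r.
  have -> : B ^+ 2 = fexp p (fun=> B ^+ 2) by rewrite /fexp -mulr_suml p1 mul1r.
  apply: ler_fexp => // a; rewrite -(real_normK (num_real (c k a))).
  rewrite lerXn2r ?nnegrE//; last exact: cexp_le.
  exact: le_trans (normr_ge0 _) (fB a).
have m2 k : fexp p (fun a => m k a ^+ 2) <= H ^+ 2 * B ^+ 2.
  apply: (@le_trans _ _ (H ^+ 2 * fexp p (fun a =>
     \sum_(s < k) (c s.+1 a - c s a) ^+ 2))); last by rewrite ler_wpM2l ?sqr_ge0.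
  rewrite -fexpZ; elim: k => [|k IH].
    by apply: ler_fexp => // a; rewrite /m /mtransf !big_ord0 mulr0 expr0n.
  have -> : fexp p (fun a => m k.+1 a ^+ 2) = fexp p (fun a => m k a ^+ 2) +
      fexp p (fun a => (h k a * (c k.+1 a - c k a)) ^+ 2) +
      2 * fexp p (fun a => (m k a * h k a) * (c k.+1 a - c k a)).
    rewrite -fexpZ -!fexpD; apply: eq_bigr => a _.
    by rewrite /m mtransfS /c; congr (_ * _); ring.
  rewrite orth; last first.
    by move=> a b rab; rewrite (am k k (leqnn k) a b rab) (ah k a b rab).
  rewrite mulr0 addr0.
  under [X in _ <= X]eq_bigr do rewrite big_ord_recr /= mulrDr.
  rewrite -/(fexp _ _) fexpD; apply: lerD => //; apply: ler_fexp => // a.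
  rewrite exprMn ler_wpM2r ?sqr_ge0// -(real_normK (num_real (h k a))).
  by rewrite lerXn2r ?nnegrE//; apply: le_trans (hH k a).
split; first exact: m2.
apply: (@le_trans _ _ (4 * fexp p (fun a => m n a ^+ 2))); last first.
  by rewrite ler_pM2l.
have aM s t : (s <= t)%N -> adapted (r t) (fun a => runmax (fun s => - m s a) s).
  elim: s => [|s IH] st a b rab /=; first by rewrite (am 0%N t st a b rab).
  by rewrite (IH (ltnW st) a b rab) (am _ _ st a b rab).
rewrite -fexpZ.
apply: (@le_trans _ _ (fexp p (fun a => 4 * m n a ^+ 2) + 4 *
   \sum_(s < n) fexp p (fun a => (runmax (fun s => - m s a) s * h s a)
                * (c s.+1 a - c s a)))).
  rewrite -fexp_sum -fexpZ -fexpD; apply: ler_fexp => // a.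
  apply: le_trans (doob_pathwise _ _) _; rewrite sqrrN lerD2l -mulrN ler_pM2l//.
  rewrite -sumrN; apply: ler_sum => s _.
  by rewrite /m mtransfS /c; lra.
rewrite big1 ?mulr0 ?addr0// => s _; apply: orth => a b rab.
by rewrite (aM _ _ (leqnn s) a b rab) (ah s a b rab).
Qed.

(** * Regret along a path *)

Lemma convex_set_segment (R : realType) (d : nat) (X : set 'rV[R]_d)
    (u v : 'rV[R]_d) (s : R) :
  convex_set X -> X u -> X v -> 0 <= s <= 1 -> X (s *: u + (1 - s) *: v).
Proof.
move=> cX Xu Xv s01.
have s01' : Itv.spec (@Itv.num_sem R) (Itv.Real `[0%Z, 1%Z]) s.
  by rewrite /= /Itv.num_sem /= num_real /= in_itv.
have := cX u v (Itv.mk s01') (mem_set Xu) (mem_set Xv).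
by move/set_mem.
Qed.

Lemma convex_set_sum (R : realType) (d : nat) (X : set 'rV[R]_d) (I : finType)
    (P : pred I) (w : I -> R) (v : I -> 'rV[R]_d) :
  convex_set X -> (forall i, 0 <= w i) -> (forall i, X (v i)) ->
  0 < \sum_(i | P i) w i ->
  X ((\sum_(i | P i) w i)^-1 *: \sum_(i | P i) w i *: v i).
Proof.
move=> cX w0 Xv; elim: (index_enum I) => [|i s IH].
  by rewrite !big_nil ltxx.
rewrite !big_cons; case: ifP => // Pi.
set W := \sum_(j <- s | P j) w j in IH *; set V := \sum_(j <- s | P j) _ in IH *.
have W0 : 0 <= W by apply: sumr_ge0.
move=> wW; have [W_0|Wn0] := eqVneq W 0.
  have -> : V = 0.
    move/eqP: W_0; rewrite psumr_eq0// => /allP W_0.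
    rewrite /V big_seq_cond big1// => j /andP[/W_0 + Pj].
    by rewrite Pj /= => /eqP ->; rewrite scale0r.
  rewrite W_0 addr0 in wW *; rewrite addr0 scalerA mulVf ?gt_eqF// scale1r.
  exact: Xv.
have Wgt0 : 0 < W by rewrite lt0r Wn0.
have := convex_set_segment (s := w i / (w i + W)) cX (Xv i) (IH Wgt0).
have -> : w i / (w i + W) *: v i + (1 - w i / (w i + W)) *: (W^-1 *: V) =
    (w i + W)^-1 *: (w i *: v i + V).
  rewrite scalerDr !scalerA mulrC; congr (_ + _ *: _).
  by field; rewrite Wn0 gt_eqF.
apply; apply/andP; split; first by apply: divr_ge0 => //; apply: ltW.
by rewrite ler_pdivrMr// mul1r lerDl.
Qed.

Lemma slope_ge0 (R : realType) (L Q : R) :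
  (forall s, 0 < s <= 1 -> 0 <= s * L + s ^+ 2 * Q) -> 0 <= L.
Proof.
move=> H; rewrite leNgt; apply/negP => L0.
(* At this [s] the term [s * Q] is at most half of [- L], so [L + s * Q] is still negative. *)
pose s := Num.min 1 (- L / (2 * (`|Q| + 1))).
have q0 : 0 < 2 * (`|Q| + 1) by have := normr_ge0 Q; lra.
have s0 : 0 < s by rewrite lt_min ltr01 divr_gt0// oppr_gt0.
have s1 : s <= 1 by rewrite ge_min lexx.
have sL : s * (2 * (`|Q| + 1)) <= - L.
  by rewrite -ler_pdivlMr// ge_min lexx orbT.
have := H s; rewrite s0 s1 => /(_ isT).
have -> : s * L + s ^+ 2 * Q = s * (L + s * Q) by ring.
rewrite pmulr_rge0// => h.
have : s * Q <= s * `|Q| by rewrite ler_wpM2l ?ler_norm// ltW.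
nra.
Qed.

Lemma dotpB (R : realType) (d : nat) (a u v : 'rV[R]_d) :
  dotp a (u - v) = \sum_i a ord0 i * (u ord0 i - v ord0 i).
Proof. by apply: eq_bigr => i _; rewrite /vcoord !mxE. Qed.

Lemma wnorm2B (R : realType) (d : nat) (a u v : 'rV[R]_d) :
  wnorm2 a (u - v) = \sum_i a ord0 i * (u ord0 i - v ord0 i) ^+ 2.
Proof. by apply: eq_bigr => i _; rewrite /vcoord !mxE. Qed.

(** Along the segment from [v] to [u] the objective changes by exactly [s * L + s ^+ 2 * Q], and
    [slope_ge0] gives the sign of [L]. Two proximal terms serve both updates, that of [x] being the
    case [E = 0]. *)
Lemma argmin_foc (R : realType) (d : nat) (X : set 'rV[R]_d)
    (g a b D E v : 'rV[R]_d) :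
  convex_set X ->
  is_argmin X (fun u => dotp g u + 2^-1 * wnorm2 D (u - a)
                        + 2^-1 * wnorm2 E (u - b)) v ->
  forall u, X u ->
  0 <= \sum_i (g ord0 i + D ord0 i * (v ord0 i - a ord0 i)
               + E ord0 i * (v ord0 i - b ord0 i)) * (u ord0 i - v ord0 i).
Proof.
move=> cX [Xv vmin] u Xu.
apply: (@slope_ge0 _ _ (2^-1 * \sum_i (D ord0 i + E ord0 i)
                          * (u ord0 i - v ord0 i) ^+ 2)).
move=> s /andP[s0 s1].
have /vmin : X (s *: u + (1 - s) *: v).
  by apply: convex_set_segment => //; rewrite ltW.
rewrite -subr_ge0; congr (0 <= _).
rewrite !wnorm2B /dotp /vcoord !mulr_sumr -!big_split /= -sumrB.
by apply: eq_bigr => i _; rewrite !mxE; field.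
Qed.

(* One round of the algorithm against an arbitrary comparator [u]: [D'], [D] are
   the old and new step sizes, [z'], [z] the old and new proximal centers. *)
Lemma regret_step (R : realType) (d : nat) (X : set 'rV[R]_d)
    (G' G D' D z' x z u : 'rV[R]_d) :
  convex_set X -> X u -> (forall i, 0 <= D' ord0 i) ->
  is_argmin X (fun v => dotp G' v + 2^-1 * wnorm2 D' (v - z')) x ->
  is_argmin X (fun v => dotp G v + 2^-1 * wnorm2 D' (v - z')
                        + 2^-1 * wnorm2 (D - D') (v - x)) z ->
  dotp G (x - u) <= \sum_i ((G ord0 i - G' ord0 i) * (x ord0 i - z ord0 i)
    + 2^-1 * D' ord0 i * (u ord0 i - z' ord0 i) ^+ 2
    - 2^-1 * D ord0 i * (u ord0 i - z ord0 i) ^+ 2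
    + 2^-1 * (D ord0 i - D' ord0 i) * (u ord0 i - x ord0 i) ^+ 2
    - 2^-1 * D ord0 i * (z ord0 i - x ord0 i) ^+ 2).
Proof.
move=> cX Xu D'0 xmin zmin.
have Xz : X z by case: zmin.
have foc_z := argmin_foc cX zmin Xu.
have xmin' : is_argmin X (fun v => dotp G' v + 2^-1 * wnorm2 D' (v - z')
                                   + 2^-1 * wnorm2 0 (v - z')) x.
  split; first by case: xmin.
  have w0 v : wnorm2 0 (v - z') = 0 :> R.
    by rewrite wnorm2B big1// => i _; rewrite mxE mul0r.
  by move=> v Xv; rewrite !w0 mulr0 !addr0; apply: xmin.2.
have foc_x := argmin_foc cX xmin' Xz.
rewrite dotpB.
have := addr_ge0 foc_z foc_x; rewrite -big_split /= => foc.
rewrite -subr_ge0; apply: le_trans foc _; rewrite -sumrB.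
apply: ler_sum => i _; rewrite !mxE.
have := D'0 i.
move: (G _ _) (G' _ _) (D _ _) (D' _ _) (z _ _) (z' _ _) (x _ _) (u _ _).
move=> g g' e e' a a' b c e'0.
rewrite -subr_ge0.
apply: (@le_trans _ _ (2^-1 * (e' * (b - a') ^+ 2))).
  by apply: mulr_ge0; rewrite ?invr_ge0// mulr_ge0// sqr_ge0.
by rewrite le_eqVlt; apply/orP; left; apply/eqP; field.
Qed.

Lemma mul_le_div_sqr (R : realFieldType) (g D a : R) :
  0 < D -> g * a <= g ^+ 2 / D + 4^-1 * D * a ^+ 2.
Proof.
move=> D0; rewrite -subr_ge0.
have -> : g ^+ 2 / D + 4^-1 * D * a ^+ 2 - g * a =
    D^-1 * (g - 2^-1 * D * a) ^+ 2 by field; rewrite gt_eqF.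
by rewrite mulr_ge0 ?sqr_ge0// invr_ge0 ltW.
Qed.

(* The increments of [k = 3/2 (y - c)^2 + m] dominate the price of moving the
   comparator from [y n] to [y n.+1]; Abel summation against the nondecreasing
   [D] then only leaves [D T] times the oscillation of [k]. *)
Lemma coord_regret (R : realFieldType) (T : nat) (eta c K : R)
    (D g x z y q : nat -> R) :
  let Delta t := y t.+1 - y t in
  let m n := \sum_(t < n) ((y t - q t) - 3 * (y t - c)) * Delta t in
  (0 < T)%N -> 0 < eta -> 0 <= D 0%N ->
  (forall t, (t < T)%N -> D t <= D t.+1) ->
  (forall t, (t < T)%N -> g t.+1 ^+ 2 = eta ^+ 2 * (D t.+1 ^+ 2 - D t ^+ 2)) ->
  x 0%N = z 0%N ->
  (forall t, (t <= T)%N -> `|y t - x t| <= eta) ->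
  (forall t, (t <= T)%N -> `|y t - c| <= eta) ->
  (forall t, (t < T)%N -> `|Delta t| <= eta) ->
  (forall t, (t < T)%N -> `|q t - x t| <= eta / T%:R) ->
  (forall t, (t <= T)%N -> - m t <= K) ->
  \sum_(t < T) (g t.+1 * (x t.+1 - z t.+1)
    + 2^-1 * D t * (y t.+1 - z t) ^+ 2
    - 2^-1 * D t.+1 * (y t.+1 - z t.+1) ^+ 2
    + 2^-1 * (D t.+1 - D t) * (y t.+1 - x t.+1) ^+ 2
    - 2^-1 * D t.+1 * (z t.+1 - x t.+1) ^+ 2)
  <= D T * (5 * eta ^+ 2 + m T + K).
Proof.
move=> Delta m T0 eta0 D0 Dmono gE xz yx yc Del qx mK.
have sq u : `|u| <= eta -> u ^+ 2 <= eta ^+ 2.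
  by move=> ue; rewrite -(real_normK (num_real u)) lerXn2r ?nnegrE// ltW.
have Dge0 t : (t <= T)%N -> 0 <= D t.
  elim: t => [//|t IH] tT; exact: le_trans (IH (ltnW tT)) (Dmono _ tT).
pose k t := 3 / 2 * (y t - c) ^+ 2 + m t.
have kK t : (t <= T)%N -> 0 <= k t + K.
  move=> tT; have := mK t tT; have := sqr_ge0 (y t - c); rewrite /k; lra.
(* Of the half of [D * (z - x) ^+ 2] gained in each round, [ga] spends a quarter at once; the other
   quarter stays on the left side and pays for [drift] in the next round. The [5 / 2] is 2 from [ga]
   plus [1 / 2] from [yxD]. *)
have inv n : (n <= T)%N -> \sum_(t < n) (g t.+1 * (x t.+1 - z t.+1)
    + 2^-1 * D t * (y t.+1 - z t) ^+ 2
    - 2^-1 * D t.+1 * (y t.+1 - z t.+1) ^+ 2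
    + 2^-1 * (D t.+1 - D t) * (y t.+1 - x t.+1) ^+ 2
    - 2^-1 * D t.+1 * (z t.+1 - x t.+1) ^+ 2)
    + 2^-1 * D n * (y n - z n) ^+ 2 + 4^-1 * D n * (z n - x n) ^+ 2
    <= D n * (k n + K + 5 / 2 * eta ^+ 2 + n%:R * (eta ^+ 2 / T%:R)).
  elim: n => [_|n IH nT].
    rewrite big_ord0 -xz subrr expr0n mulr0 addr0 add0r mul0r addr0.
    have := kK 0%N isT; have := sq _ (yx 0%N isT); have := sqr_ge0 eta => *; nra.
  rewrite big_ord_recr /=; have {IH} := IH (ltnW nT).
  set S := \sum_(t < n) _ => IH.
  have Dn := Dge0 n (ltnW nT); have DS := Dmono n nT.
  have ga : g n.+1 * (x n.+1 - z n.+1) <= 2 * eta ^+ 2 * (D n.+1 - D n)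
      + 4^-1 * D n.+1 * (x n.+1 - z n.+1) ^+ 2.
    (* A zero initial step size is allowed; as long as [D] is 0, so is [g]. *)
    have [DS0|DSn0] := eqVneq (D n.+1) 0.
      have Dn0 : D n = 0 by apply/eqP; rewrite eq_le Dn -DS0 DS.
      have : g n.+1 ^+ 2 = 0 by rewrite gE// DS0 Dn0 subrr mulr0.
      move/eqP; rewrite sqrf_eq0 => /eqP ->.
      by rewrite DS0 Dn0 !(mul0r, subrr, mulr0) addr0.
    have DSgt0 : 0 < D n.+1 by rewrite lt0r DSn0 (le_trans Dn).
    apply: le_trans (mul_le_div_sqr _ _ DSgt0) _; rewrite lerD2r.
    rewrite ler_pdivrMr// gE//.
    have -> : 2 * eta ^+ 2 * (D n.+1 - D n) * D n.+1 =
      eta ^+ 2 * (D n.+1 ^+ 2 - D n ^+ 2) + eta ^+ 2 * (D n.+1 - D n) ^+ 2 by ring.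
    by rewrite lerDl mulr_ge0 ?sqr_ge0.
  (* Expand in [Delta n] and split [y - z] into [y - q], [q - x] and [x - z]. The last product costs
     a further [Delta ^+ 2], so [3 / 2 * Delta ^+ 2] in all: the second-order part of the increment
     of [3 / 2 * (y - c) ^+ 2], whose first-order part is removed by the [- 3] in [m]. *)
  have drift : 2^-1 * (y n.+1 - z n) ^+ 2 <= 2^-1 * (y n - z n) ^+ 2 +
      4^-1 * (z n - x n) ^+ 2 + (k n.+1 - k n + eta ^+ 2 / T%:R).
    have kE : k n.+1 - k n = 3 / 2 * Delta n ^+ 2 + (y n - q n) * Delta n.
      by rewrite /k /m big_ord_recr /= /Delta; field.
    have qD : (q n - x n) * Delta n <= eta ^+ 2 / T%:R.
      apply: le_trans (ler_norm _) _; rewrite normrM expr2 mulrAC.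
      by apply: ler_pM => //; [exact: qx|exact: Del].
    rewrite kE; have := sqr_ge0 (2^-1 * (z n - x n) + Delta n).
    have -> : y n.+1 = y n + Delta n by rewrite /Delta; ring.
    move: (Delta n) qD => e; nra.
  have := ler_wpM2l Dn drift => {}drift.
  have yxS := sq _ (yx n.+1 nT).
  have yxD : (D n.+1 - D n) * (y n.+1 - x n.+1) ^+ 2
      <= (D n.+1 - D n) * eta ^+ 2 by rewrite ler_wpM2l// subr_ge0.
  (* [K] makes this factor nonnegative, so that [D n] may be raised to [D n.+1]. *)
  have kKD : D n * (k n.+1 + K) <= D n.+1 * (k n.+1 + K).
    by rewrite ler_wpM2r// kK.
  have e0 : 0 <= n.+1%:R * (eta ^+ 2 / T%:R).
    by rewrite mulr_ge0// divr_ge0// sqr_ge0.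
  have eD : D n * (n.+1%:R * (eta ^+ 2 / T%:R)) <=
      D n.+1 * (n.+1%:R * (eta ^+ 2 / T%:R)) by rewrite ler_wpM2r.
  rewrite -natr1 in eD e0 *.
  move: (k n.+1) (k n) (eta ^+ 2 / T%:R) (n%:R) drift kKD eD IH => *; nra.
(* The constant 5 is [5 / 2] from the rounds, 1 from quantization and [3 / 2] from [k T]. *)
have := inv T (leqnn T).
have T0R : T%:R != 0 :> R by rewrite pnatr_eq0 -lt0n.
have -> : T%:R * (eta ^+ 2 / T%:R) = eta ^+ 2 by field.
set S := \sum_(t < T) _ => h.
have DT := Dge0 T (leqnn T).
have a0 := mulr_ge0 DT (sqr_ge0 (y T - z T)).
have b0 := mulr_ge0 DT (sqr_ge0 (z T - x T)).
have := ler_wpM2l DT (sq _ (yc T (leqnn T))).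
rewrite /k in h; nra.
Qed.

(** The square root splits into initial, gradient and noise parts, each separated from [Y / eta] by
    Young's inequality. The gradient weight is tuned to leave [SF / beta / 4], the amount that
    cocoercivity can absorb. *)
Lemma mul_stepsize_le (R : realType) (D Y g0 eta beta lam SF SX : R) :
  0 <= D -> 0 <= Y -> 0 <= g0 -> 0 < eta -> 0 < beta -> 0 < lam ->
  0 <= SF -> 0 <= SX ->
  eta ^+ 2 * D ^+ 2 <= eta ^+ 2 * g0 ^+ 2 + 2 * SF + 2 * SX ->
  D * Y <= g0 * (2^-1 * (Y ^+ 2 / eta ^+ 2 + eta ^+ 2)) + SF / beta / 4
    + 2 * beta * (Y ^+ 2 / eta ^+ 2) + lam * SX
    + (2 * lam)^-1 * (Y ^+ 2 / eta ^+ 2).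
Proof.
move=> D0 Y0 g00 eta0 b0 l0 SF0 SX0 hD.
have e0 : eta != 0 by rewrite gt_eqF.
pose a := Num.sqrt (2 * SF); pose b := Num.sqrt (2 * SX); pose v := Y / eta.
have a0 : 0 <= a by apply: sqrtr_ge0.
have b'0 : 0 <= b by apply: sqrtr_ge0.
have v0 : 0 <= v by rewrite divr_ge0// ltW.
have aE : a ^+ 2 = 2 * SF by rewrite sqr_sqrtr ?mulr_ge0.
have bE : b ^+ 2 = 2 * SX by rewrite sqr_sqrtr ?mulr_ge0.
have De : eta * D <= eta * g0 + a + b.
  have eg0 : 0 <= eta * g0 by rewrite mulr_ge0// ltW.
  rewrite -(@ler_pXn2r _ 2)//; first last.
  - by rewrite nnegrE !addr_ge0.
  - by rewrite nnegrE mulr_ge0// ltW.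
  rewrite exprMn; apply: le_trans hD _; rewrite -aE -bE.
  have := mulr_ge0 eg0 a0; have := mulr_ge0 eg0 b'0; have := mulr_ge0 a0 b'0.
  nra.
have YE : Y ^+ 2 / eta ^+ 2 = v ^+ 2 by rewrite /v expr_div_n.
have DYE : D * Y = eta * D * v by rewrite /v; field.
rewrite YE DYE; apply: le_trans (ler_wpM2r v0 De) _.
rewrite (mulrDl (_ + a)) (mulrDl (_ * g0)).
have h1 : eta * g0 * v <= g0 * (2^-1 * (v ^+ 2 + eta ^+ 2)).
  rewrite [_ * g0]mulrC -mulrA ler_wpM2l//; have := sqr_ge0 (eta - v); nra.
have h2 : a * v <= SF / beta / 4 + 2 * beta * v ^+ 2.
  have -> : SF / beta / 4 = a ^+ 2 / (8 * beta) by rewrite aE; field; rewrite gt_eqF.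
  have b8 : 0 < 8 * beta by rewrite mulr_gt0.
  have := mul_le_div_sqr a v b8.
  by have -> : 4^-1 * (8 * beta) * v ^+ 2 = 2 * beta * v ^+ 2 by field.
have h3 : b * v <= lam * SX + (2 * lam)^-1 * v ^+ 2.
  have l2 : 0 < 2 / lam by rewrite divr_gt0.
  have := mul_le_div_sqr b v l2; rewrite bE.
  have -> : 2 * SX / (2 / lam) = lam * SX by field; rewrite gt_eqF.
  by have -> : 4^-1 * (2 / lam) * v ^+ 2 = (2 * lam)^-1 * v ^+ 2
    by field; rewrite gt_eqF.
lra.
Qed.

(** A squared increment is at most twice the sum of the squared distances of its ends to [c], and
    each distance is shared by two increments. [f 0] is absent from the right-hand sum, so the first
    increment is kept as it is. *)
Lemma sum_sqr_increments_le (R : realFieldType) (f : nat -> R) (c : R) (T : nat) :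
  (0 < T)%N ->
  4^-1 * \sum_(t < T) (f t.+1 - f t) ^+ 2 <=
    \sum_(t < T) (f t.+1 - c) ^+ 2 + 4^-1 * (f 1%N - f 0%N) ^+ 2.
Proof.
case: T => // n _.
(* The added term is the half of the last distance that no increment has used yet. *)
suff : 4^-1 * \sum_(t < n.+1) (f t.+1 - f t) ^+ 2 + 2^-1 * (f n.+1 - c) ^+ 2 <=
    \sum_(t < n.+1) (f t.+1 - c) ^+ 2 + 4^-1 * (f 1%N - f 0%N) ^+ 2.
  have := sqr_ge0 (f n.+1 - c); lra.
elim: n => [|n IH].
  rewrite !big_ord_recr !big_ord0 /=; have := sqr_ge0 (f 1%N - c); lra.
rewrite big_ord_recr [in X in _ <= X]big_ord_recr /=.
set A := \sum_(t < n.+1) _ in IH *; set B := \sum_(t < n.+1) _ in IH *.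
have := sqr_ge0 (f n.+2 - c + (f n.+1 - c)); nra.
Qed.

Lemma coord_dist_le (R : realType) (d : nat) (X : set 'rV[R]_d) (eta : R)
    (u v : 'rV[R]_d) i :
  (forall u v, X u -> X v -> infnorm (u - v) <= eta) -> X u -> X v ->
  `|u ord0 i - v ord0 i| <= eta.
Proof.
move=> Xeta Xu Xv; apply: le_trans (Xeta _ _ Xu Xv).
have := le_bigmax 0 (fun i => `|vcoord (u - v) i|) i.
by rewrite /vcoord !mxE.
Qed.

Lemma DstepE (R : realType) (d : nat) (g0 eta : R) (G : nat -> 'rV[R]_d) t i :
  Dstep g0 eta G t ord0 i = eta^-1 * Num.sqrt (eta ^+ 2 * g0 ^+ 2 +
      \sum_(s < t) (G s.+1 ord0 i - G s ord0 i) ^+ 2).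
Proof. by rewrite mxE big_add1 big_mkord. Qed.

Lemma Dstep_ge0 (R : realType) (d : nat) (g0 eta : R) (G : nat -> 'rV[R]_d) t i :
  0 < eta -> 0 <= Dstep g0 eta G t ord0 i.
Proof. by move=> eta0; rewrite DstepE mulr_ge0 ?sqrtr_ge0// invr_ge0 ltW. Qed.

Lemma Dstep_sqr (R : realType) (d : nat) (g0 eta : R) (G : nat -> 'rV[R]_d) t i :
  0 < eta -> eta ^+ 2 * Dstep g0 eta G t ord0 i ^+ 2 =
    eta ^+ 2 * g0 ^+ 2 + \sum_(s < t) (G s.+1 ord0 i - G s ord0 i) ^+ 2.
Proof.
move=> eta0; rewrite DstepE exprMn mulrA exprVn mulfV ?sqrf_eq0 ?gt_eqF// mul1r.
rewrite sqr_sqrtr//; apply: addr_ge0; first by apply: mulr_ge0; apply: sqr_ge0.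
by apply: sumr_ge0 => s _; apply: sqr_ge0.
Qed.

Lemma Dstep_mono (R : realType) (d : nat) (g0 eta : R) (G : nat -> 'rV[R]_d) t i :
  0 < eta -> Dstep g0 eta G t ord0 i <= Dstep g0 eta G t.+1 ord0 i.
Proof.
move=> eta0; rewrite !DstepE ler_wpM2l ?invr_ge0 ?(ltW eta0)//.
by apply: ler_wsqrtr; rewrite lerD2l big_ord_recr /= lerDl sqr_ge0.
Qed.

Lemma cocoercive_lipschitz (R : realType) (d : nat) (beta a u : 'rV[R]_d) :
  (forall i, 0 < vcoord beta i) ->
  wnorm2 (vinv beta) a <= dotp a u -> wnorm2 (vinv beta) a <= wnorm2 beta u.
Proof.
move=> b0 h.
suff : 2 * dotp a u <= wnorm2 (vinv beta) a + wnorm2 beta u by lra.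
rewrite mulr_sumr -big_split /=; apply: ler_sum => i _.
have := b0 i; rewrite /vcoord mxE /vcoord => bi; rewrite -subr_ge0.
have -> : (beta ord0 i)^-1 * a ord0 i ^+ 2 + beta ord0 i * u ord0 i ^+ 2
    - 2 * (a ord0 i * u ord0 i) =
    (beta ord0 i)^-1 * (a ord0 i - beta ord0 i * u ord0 i) ^+ 2.
  by field; rewrite gt_eqF.
by rewrite mulr_ge0 ?sqr_ge0// invr_ge0 ltW.
Qed.

(** The [m] of [coord_regret] with [c] the starting point; [driftY] is the factor of [D T] there,
    with the running maximum as [K]. *)
Definition drift (R : realType) (d : nat) (x0 : 'rV[R]_d) (q y : nat -> 'rV[R]_d)
    (i : 'I_d) (n : nat) : R :=
  \sum_(t < n) ((y t ord0 i - q t ord0 i) - 3 * (y t ord0 i - x0 ord0 i))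
               * (y t.+1 ord0 i - y t ord0 i).

Definition driftY (R : realType) (d : nat) (eta : R) (x0 : 'rV[R]_d)
    (q y : nat -> 'rV[R]_d) (T : nat) (i : 'I_d) : R :=
  5 * eta ^+ 2 + drift x0 q y i T + runmax (fun n => - drift x0 q y i n) T.

(** Cocoercivity passes from [F y] to [F (x t)] with a gain in squared [B^-1]-norms, which pays for
    the gradient part of [D_T]. The first two sums on the right are those whose means vanish up to
    quantization. *)
Lemma path_err (R : realType) (d : nat) (X : set 'rV[R]_d) (eta g0 lam : R)
    (beta x0 y : 'rV[R]_d) (F : 'rV[R]_d -> 'rV[R]_d) (T : nat)
    (G x z ys q : nat -> 'rV[R]_d) :
  let xi t := G t - F (x t) in
  let Y := driftY eta x0 q ys T in
  convex_set X -> X x0 -> 0 < eta ->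
  (forall u v, X u -> X v -> infnorm (u - v) <= eta) ->
  (forall i, 0 < vcoord beta i) ->
  (forall u v, X u -> X v ->
     wnorm2 (vinv beta) (F u - F v) <= dotp (F u - F v) (u - v)) ->
  0 <= g0 -> 0 < lam -> (0 < T)%N ->
  x 0%N = x0 -> z 0%N = x0 ->
  (forall t, (0 < t <= T)%N ->
     is_argmin X (fun u => dotp (G t.-1) u
        + 2^-1 * wnorm2 (Dstep g0 eta G t.-1) (u - z t.-1)) (x t)
     /\
     is_argmin X (fun u => dotp (G t) u
        + 2^-1 * wnorm2 (Dstep g0 eta G t.-1) (u - z t.-1)
        + 2^-1 * wnorm2 (Dstep g0 eta G t - Dstep g0 eta G t.-1)
                        (u - x t)) (z t)) ->
  X y -> (forall t, (t <= T)%N -> X (ys t)) ->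
  (forall t i, (t <= T)%N -> `|q t ord0 i - x t ord0 i| <= eta / T%:R) ->
  \sum_(t < T) dotp (F y) (x t.+1 - y) <=
    \sum_(t < T) dotp (F (x t.+1)) (ys t.+1 - y)
    - \sum_(t < T) dotp (xi t.+1) (x t.+1 - ys t.+1)
    + \sum_i (g0 * (2^-1 * (Y i ^+ 2 / eta ^+ 2 + eta ^+ 2))
         + 2 * beta ord0 i * (Y i ^+ 2 / eta ^+ 2)
         + (2 * lam)^-1 * (Y i ^+ 2 / eta ^+ 2))
    + lam * \sum_(t < T) \sum_i (2 * xi t.+1 ord0 i ^+ 2 + 2 * xi t ord0 i ^+ 2)
    + 4^-1 * (trace_diag beta * eta ^+ 2).
Proof.
move=> xi Y cX Xx0 eta0 Xeta b0 coco g00 lam0 T0 x00 z00 alg Xy Xys qx.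
have Xinf u v i := @coord_dist_le _ _ _ _ u v i Xeta.
have Xx t : (t <= T)%N -> X (x t).
  by case: t => [_|t tT]; [rewrite x00|case: (alg t.+1 tT) => -[]].
pose D t i := Dstep g0 eta G t ord0 i.
have regret : \sum_(t < T) dotp (G t.+1) (x t.+1 - ys t.+1) <=
    \sum_i D T i * Y i.
  apply: (@le_trans _ _ (\sum_(t < T) \sum_i
     ((G t.+1 ord0 i - G t ord0 i) * (x t.+1 ord0 i - z t.+1 ord0 i)
    + 2^-1 * D t i * (ys t.+1 ord0 i - z t ord0 i) ^+ 2
    - 2^-1 * D t.+1 i * (ys t.+1 ord0 i - z t.+1 ord0 i) ^+ 2
    + 2^-1 * (D t.+1 i - D t i) * (ys t.+1 ord0 i - x t.+1 ord0 i) ^+ 2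
    - 2^-1 * D t.+1 i * (z t.+1 ord0 i - x t.+1 ord0 i) ^+ 2))).
    apply: ler_sum => t _; have [ax az] := alg t.+1 (ltn_ord t).
    apply: (regret_step cX _ _ ax az) => [|i]; last exact: Dstep_ge0.
    exact: Xys.
  rewrite exchange_big /=; apply: ler_sum => i _.
  apply: (@coord_regret _ T eta (x0 ord0 i) _ (fun t => D t i)
    (fun t => G t ord0 i - G t.-1 ord0 i) (fun t => x t ord0 i)
    (fun t => z t ord0 i) (fun t => ys t ord0 i) (fun t => q t ord0 i)) => //=.
  - exact: Dstep_ge0.
  - by move=> t _; apply: Dstep_mono.
  - by move=> t _; rewrite mulrBr !Dstep_sqr// big_ord_recr /=; ring.
  - by rewrite x00 z00.
  - by move=> t tT; apply: Xinf; [apply: Xys|apply: Xx].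
  - by move=> t tT; apply: Xinf => //; apply: Xys.
  - by move=> t tT; apply: Xinf; apply: Xys => //; apply: ltnW.
  - by move=> t tT; apply: qx; apply: ltnW.
  - by move=> t tT; apply: (@le_runmax _ (fun n => - drift x0 q ys i n)).
have Y0 i : 0 <= Y i.
  have := @le_runmax _ (fun n => - drift x0 q ys i n) T T (leqnn T).
  have := sqr_ge0 eta; rewrite /Y /driftY; lra.
pose SF i := \sum_(t < T) (F (x t.+1) ord0 i - F (x t) ord0 i) ^+ 2.
pose SX i := \sum_(t < T) (xi t.+1 ord0 i - xi t ord0 i) ^+ 2.
have DY i : D T i * Y i <= (g0 * (2^-1 * (Y i ^+ 2 / eta ^+ 2 + eta ^+ 2))
         + 2 * beta ord0 i * (Y i ^+ 2 / eta ^+ 2)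
         + (2 * lam)^-1 * (Y i ^+ 2 / eta ^+ 2)) + lam * SX i +
         SF i / beta ord0 i / 4.
  have SF0 : 0 <= SF i by apply: sumr_ge0 => t _; apply: sqr_ge0.
  have SX0 : 0 <= SX i by apply: sumr_ge0 => t _; apply: sqr_ge0.
  have := @mul_stepsize_le R (D T i) (Y i) g0 eta (beta ord0 i) lam (SF i) (SX i)
    (Dstep_ge0 _ _ _ _ eta0) (Y0 i) g00 eta0 (b0 i) lam0 SF0 SX0.
  have -> : eta ^+ 2 * D T i ^+ 2 <= eta ^+ 2 * g0 ^+ 2 + 2 * SF i + 2 * SX i.
    rewrite /D Dstep_sqr// -addrA lerD2l !mulr_sumr -big_split /=.
    apply: ler_sum => t _; rewrite !mxE.
    set a := F _ _ _; set b := F _ _ _.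
    have := sqr_ge0 ((a - b) - (G t.+1 ord0 i - a - (G t ord0 i - b))); nra.
  by move=> /(_ isT); lra.
have SXle i : SX i <= \sum_(t < T) (2 * xi t.+1 ord0 i ^+ 2 + 2 * xi t ord0 i ^+ 2).
  apply: ler_sum => t _; have := sqr_ge0 (xi t.+1 ord0 i + xi t ord0 i); nra.
have gain : \sum_i SF i / beta ord0 i / 4 <=
    \sum_(t < T) wnorm2 (vinv beta) (F (x t.+1) - F y)
    + 4^-1 * (trace_diag beta * eta ^+ 2).
  (* The gain covers only [x 1], ..., [x T], so the increment from [x 0] is bounded by Lipschitz
     continuity instead. *)
  have first_step : wnorm2 (vinv beta) (F (x 1%N) - F (x 0%N)) <=
      trace_diag beta * eta ^+ 2.
    apply: le_trans (cocoercive_lipschitz b0 (coco _ _ (Xx _ T0) (Xx 0%N isT))) _.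
    rewrite wnorm2B mulr_suml; apply: ler_sum => i _.
    apply: ler_wpM2l; first exact: ltW (b0 i).
    rewrite -(real_normK (num_real (x 1%N ord0 i - x 0%N ord0 i))).
    by rewrite lerXn2r ?nnegrE ?(ltW eta0)//; apply: Xinf; apply: Xx.
  apply: le_trans (lerD (lexx _) (ler_wpM2l (_ : 0 <= 4^-1) first_step)) => //.
  rewrite exchange_big /= mulr_sumr -big_split /=; apply: ler_sum => i _.
  have := sum_sqr_increments_le (fun t => F (x t) ord0 i) (F y ord0 i) T0.
  have bi : 0 <= (beta ord0 i)^-1 by rewrite invr_ge0 ltW ?b0.
  move/(ler_wpM2l bi); rewrite /vcoord !mxE -/(SF i).
  have -> : SF i / beta ord0 i / 4 = (beta ord0 i)^-1 * (4^-1 * SF i) by ring.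
  move=> h; apply: le_trans h _; rewrite mulrDr mulr_sumr [in X in _ + X]mulrCA.
  by rewrite lerD2r; apply: ler_sum => t _; rewrite !mxE.
have cocoy : \sum_(t < T) dotp (F y) (x t.+1 - y) <=
    \sum_(t < T) dotp (F (x t.+1)) (x t.+1 - y)
    - \sum_(t < T) wnorm2 (vinv beta) (F (x t.+1) - F y).
  rewrite -sumrB; apply: ler_sum => t _.
  have := coco _ _ (Xx t.+1 (ltn_ord t)) Xy.
  suff -> : dotp (F (x t.+1) - F y) (x t.+1 - y) =
    dotp (F (x t.+1)) (x t.+1 - y) - dotp (F y) (x t.+1 - y) by lra.
  by rewrite /dotp -sumrB; apply: eq_bigr => i _; rewrite /vcoord !mxE; ring.
have split : \sum_(t < T) dotp (F (x t.+1)) (x t.+1 - y) =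
    \sum_(t < T) dotp (F (x t.+1)) (ys t.+1 - y)
    - \sum_(t < T) dotp (xi t.+1) (x t.+1 - ys t.+1)
    + \sum_(t < T) dotp (G t.+1) (x t.+1 - ys t.+1).
  rewrite -sumrB -big_split /=; apply: eq_bigr => t _.
  rewrite /dotp -sumrB -big_split /=; apply: eq_bigr => i _.
  by rewrite /vcoord !mxE; ring.
set SZ := (X in _ <= _ - _ + X + _ + _).
have DYs : \sum_i D T i * Y i <=
    SZ + \sum_i lam * SX i + \sum_i SF i / beta ord0 i / 4.
  by rewrite /SZ -!big_split /=; apply: ler_sum => i _; apply: DY.
have SXs : \sum_i lam * SX i <= lam * \sum_(t < T) \sum_i
   (2 * xi t.+1 ord0 i ^+ 2 + 2 * xi t ord0 i ^+ 2).
  rewrite exchange_big -mulr_sumr /= ler_pM2l//.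
  by apply: ler_sum => i _; apply: SXle.
lra.
Qed.

(** * Quantization *)

Lemma trace_diag_ge0 (R : realType) (d : nat) (beta : 'rV[R]_d) :
  (forall i, 0 < vcoord beta i) -> 0 <= trace_diag beta.
Proof. by move=> b0; apply: sumr_ge0 => i _; apply: ltW. Qed.

Lemma cocoercive_coord_lipschitz (R : realType) (d : nat)
    (beta a u : 'rV[R]_d) (delta : R) :
  (forall i, 0 < vcoord beta i) -> 0 <= delta ->
  wnorm2 (vinv beta) a <= dotp a u -> (forall i, `|u ord0 i| <= delta) ->
  forall i, `|a ord0 i| <= trace_diag beta * delta.
Proof.
move=> b0 d0 h ud i.
have t0 := trace_diag_ge0 b0.
have bi : 0 < beta ord0 i := b0 i.
have bt : beta ord0 i <= trace_diag beta.
  rewrite /trace_diag (bigD1 i) //= lerDl.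
  by apply: sumr_ge0 => j _; apply: ltW.
have h1 : a ord0 i ^+ 2 / beta ord0 i <= trace_diag beta * delta ^+ 2.
  apply: (@le_trans _ _ (wnorm2 (vinv beta) a)).
    rewrite /wnorm2 (bigD1 i) //= /vcoord !mxE /vcoord mulrC lerDl.
    apply: sumr_ge0 => j _; rewrite mulr_ge0 ?sqr_ge0// mxE invr_ge0.
    exact: ltW (b0 j).
  apply: le_trans (cocoercive_lipschitz b0 h) _.
  rewrite mulr_suml; apply: ler_sum => j _; apply: ler_wpM2l; first exact: ltW.
  by rewrite -(real_normK (num_real (vcoord u j))) lerXn2r ?nnegrE//; apply: ud.
rewrite -(@ler_pXn2r _ 2)// ?nnegrE ?mulr_ge0// real_normK ?num_real//.
move: h1; rewrite ler_pdivrMr// => h1; apply: le_trans h1 _.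
by rewrite exprMn mulrAC [X in X * _]mulrC; apply: ler_wpM2r;
  rewrite ?sqr_ge0// expr2 ler_wpM2r.
Qed.

(** Cocoercivity makes [F] Lipschitz and bounded on [X], so the gap is uniformly continuous in its
    three points jointly. This allows points to be exchanged with their representatives on the
    net. *)
Lemma gap_continuous (R : realType) (d : nat) (X : set 'rV[R]_d) (eta e : R)
    (beta x0 : 'rV[R]_d) (F : 'rV[R]_d -> 'rV[R]_d) :
  X x0 -> 0 < eta ->
  (forall u v, X u -> X v -> infnorm (u - v) <= eta) ->
  (forall i, 0 < vcoord beta i) ->
  (forall u v, X u -> X v ->
     wnorm2 (vinv beta) (F u - F v) <= dotp (F u - F v) (u - v)) ->
  0 < e ->
  exists2 delta0, 0 < delta0 & forall delta, 0 < delta <= delta0 ->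
  forall u u' v v' y y', X u -> X u' -> X v -> X v' -> X y -> X y' ->
  (forall i, `|u ord0 i - u' ord0 i| <= delta) ->
  (forall i, `|v ord0 i - v' ord0 i| <= delta) ->
  (forall i, `|y ord0 i - y' ord0 i| <= delta) ->
  dotp (F u) (v - y) <= dotp (F u') (v' - y') + e.
Proof.
move=> Xx0 eta0 Xeta b0 coco e0.
have Xinf u v i := @coord_dist_le _ _ _ _ u v i Xeta.
have t0 := trace_diag_ge0 b0.
have lipF u v del : X u -> X v -> 0 <= del ->
    (forall i, `|u ord0 i - v ord0 i| <= del) ->
    forall i, `|F u ord0 i - F v ord0 i| <= trace_diag beta * del.
  move=> Xu Xv d0 uv i.
  have := cocoercive_coord_lipschitz b0 d0 (coco _ _ Xu Xv) _ i.
  by rewrite !mxE; apply => j; rewrite !mxE.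
pose M := \sum_i `|F x0 ord0 i| + trace_diag beta * eta.
have FM u i : X u -> `|F u ord0 i| <= M.
  move=> Xu; have := lipF u x0 eta Xu Xx0 (ltW eta0) (fun i => Xinf _ _ i Xu Xx0) i.
  have := ler_normD (F u ord0 i - F x0 ord0 i) (F x0 ord0 i); rewrite subrK.
  have : `|F x0 ord0 i| <= \sum_i `|F x0 ord0 i|.
    by rewrite (bigD1 i) //= lerDl sumr_ge0.
  rewrite /M; lra.
have M0 : 0 <= M by rewrite addr_ge0 ?sumr_ge0// mulr_ge0// ltW.
pose L := trace_diag beta * eta + 2 * M.
have L0 : 0 <= L by rewrite /L addr_ge0 ?mulr_ge0 ?(ltW eta0).
have dL0 : 0 < d%:R * L + 1 by rewrite ltr_pwDr// mulr_ge0.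
exists (e / (d%:R * L + 1)); first by rewrite divr_gt0.
move=> delta /andP[delta0 delta1] u u' v v' y y' Xu Xu' Xv Xv' Xy Xy' uu vv yy.
rewrite -lerBlDl; apply: (@le_trans _ _ (\sum_(i < d) delta * L)); last first.
  rewrite sumr_const card_ord -mulr_natl.
  move: delta1; rewrite ler_pdivlMr//; nra.
rewrite /dotp -sumrB; apply: ler_sum => i _; rewrite /vcoord !mxE.
have h1 := lipF u u' delta Xu Xu' (ltW delta0) uu i.
have h2 := Xinf v y i Xv Xy; have h3 := FM u' i Xu'.
have h4 : `|(v ord0 i - v' ord0 i) - (y ord0 i - y' ord0 i)| <= 2 * delta.
  apply: le_trans (ler_normB _ _) _; have := vv i; have := yy i; lra.
have -> : F u ord0 i * (v ord0 i - y ord0 i) - F u' ord0 i * (v' ord0 i - y' ord0 i)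
  = (F u ord0 i - F u' ord0 i) * (v ord0 i - y ord0 i) +
    F u' ord0 i * ((v ord0 i - v' ord0 i) - (y ord0 i - y' ord0 i)) by ring.
apply: le_trans (ler_norm _) _; apply: le_trans (ler_normD _ _) _.
have -> : delta * L = trace_diag beta * delta * eta + M * (2 * delta).
  by rewrite /L; ring.
by rewrite !normrM; apply: lerD; apply: ler_pM.
Qed.

(** Threshold bits rather than cell indices: each bit compares one coordinate with a constant, so
    that its events are preimages of half-lines. *)
Definition grid (R : realType) (d N : nat) (lo : 'rV[R]_d) (delta : R)
    (v : 'rV[R]_d) : {ffun 'I_d * 'I_N -> bool} :=
  [ffun ij : 'I_d * 'I_N => lo ord0 ij.1 + ij.2%:R * delta <= v ord0 ij.1].

Lemma grid_close (R : realType) (d N : nat) (lo : 'rV[R]_d) (delta L : R)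
    (u v : 'rV[R]_d) :
  0 < delta -> L < N%:R * delta ->
  (forall i, 0 <= u ord0 i - lo ord0 i <= L) ->
  (forall i, 0 <= v ord0 i - lo ord0 i <= L) ->
  grid N lo delta u = grid N lo delta v ->
  forall i, `|u ord0 i - v ord0 i| <= delta.
Proof.
move=> delta0 LN.
suff half (a b : 'rV[R]_d) i : (forall i, 0 <= a ord0 i - lo ord0 i <= L) ->
    grid N lo delta a = grid N lo delta b -> a ord0 i - b ord0 i <= delta.
  move=> uL vL uv i; rewrite ler_norml half// andbT.
  by rewrite lerNl opprB half.
move=> aL ab; rewrite leNgt; apply/negP => h.
have /andP[a0 a1] := aL i.
(* The highest threshold passed by [a]; [b] passes it too and so cannot lie more than [delta] below
   [a]. *)
pose j := Num.truncn ((a ord0 i - lo ord0 i) / delta).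
have q0 : 0 <= (a ord0 i - lo ord0 i) / delta by rewrite divr_ge0// ltW.
have /andP[j1 j2] := truncn_itv q0; rewrite -/j in j1 j2.
have jN : (j < N)%N.
  rewrite -(ltr_nat R) -(ltr_pM2r delta0); apply: le_lt_trans LN.
  apply: le_trans a1; by rewrite -ler_pdivlMr.
move/ffunP/(_ (i, Ordinal jN)): ab; rewrite !ffunE /=.
have -> : lo ord0 i + j%:R * delta <= a ord0 i.
  by move: j1; rewrite ler_pdivlMr//; lra.
move/esym => h2.
by move: j2; rewrite ltr_pdivrMr// -natr1; lra.
Qed.

Lemma quantization (R : realType) (d : nat) (X : set 'rV[R]_d) (x0 : 'rV[R]_d)
    (eta delta : R) :
  X x0 -> 0 < delta -> (forall u v, X u -> X v -> infnorm (u - v) <= eta) ->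
  exists (N : nat) (lo : 'rV[R]_d) (rep : {ffun 'I_d * 'I_N -> bool} -> 'rV[R]_d),
    (forall k, X (rep k)) /\
    (forall v i, X v -> `|rep (grid N lo delta v) ord0 i - v ord0 i| <= delta).
Proof.
move=> Xx0 delta0 Xeta.
have Xinf u v i := @coord_dist_le _ _ _ _ u v i Xeta.
pose N := (Num.truncn (2 * `|eta| / delta)).+1.
pose lo := \row_i (x0 ord0 i - eta).
(* Codes not attained on [X] fall back to [x0], so every representative is feasible. *)
pose rep k := xget x0 [set v | X v /\ grid N lo delta v = k].
have loP v i : X v -> 0 <= v ord0 i - lo ord0 i <= 2 * `|eta|.
  move=> Xv; rewrite mxE; have := Xinf v x0 i Xv Xx0.
  by rewrite ler_norml => /andP[] ? ?; have := ler_norm eta => ?; apply/andP; split; lra.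
exists N, lo, rep; split => [k|v i Xv].
  by rewrite /rep; case: xgetP => [v -> []//|_].
have [Xr rv] : X (rep (grid N lo delta v)) /\
    grid N lo delta (rep (grid N lo delta v)) = grid N lo delta v.
  have ex : exists u, [set u | X u /\ grid N lo delta u = grid N lo delta v] u.
    by exists v.
  exact: (xgetPex x0 ex).
apply: (grid_close delta0 _ _ _ rv) => [|j|j]; try exact: loP.
by rewrite /N -ltr_pdivrMr//; apply: truncnS_gt.
Qed.

(** * Upper bounds on means *)

(** Integrability travels with the bound because additivity of the integral asks for it at every
    step. *)
Definition mean_le (d0 : measure_display) (Omega : measurableType d0)
    (R : realType) (P : probability Omega R) (f : Omega -> R) (v : R) : Prop :=
  P.-integrable setT (EFin \o f) /\ (\int[P]_w (f w)%:E <= v%:E)%E.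

Lemma mean_leD (d0 : measure_display) (Omega : measurableType d0)
    (R : realType) (P : probability Omega R) (f g : Omega -> R) (u v : R) :
  mean_le P f u -> mean_le P g v -> mean_le P (fun w => f w + g w) (u + v).
Proof.
move=> [fi fu] [gi gv]; split.
  rewrite (_ : _ \o _ = (EFin \o f) \+ (EFin \o g))%E; first exact: integrableD.
  by apply/funext => w /=; rewrite EFinD.
under eq_integral do rewrite EFinD.
by rewrite integralD// EFinD leeD.
Qed.

Lemma mean_leZ (d0 : measure_display) (Omega : measurableType d0)
    (R : realType) (P : probability Omega R) (f : Omega -> R) (k v : R) :
  0 <= k -> mean_le P f v -> mean_le P (fun w => k * f w) (k * v).
Proof.
move=> k0 [fi fv]; split.
  rewrite (_ : _ \o _ = (fun w => k%:E * (EFin \o f) w)%E); first exact: integrableZl.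
  by apply/funext => w /=; rewrite EFinM.
under eq_integral do rewrite EFinM.
by rewrite integralZl// EFinM lee_wpmul2l.
Qed.

Lemma mean_le_weaken (d0 : measure_display) (Omega : measurableType d0)
    (R : realType) (P : probability Omega R) (f : Omega -> R) (u v : R) :
  u <= v -> mean_le P f u -> mean_le P f v.
Proof. by move=> uv [fi fu]; split=> //; apply: le_trans fu _; rewrite lee_fin. Qed.

Lemma mean_le_cst (d0 : measure_display) (Omega : measurableType d0)
    (R : realType) (P : probability Omega R) (c : R) : mean_le P (fun=> c) c.
Proof.
split; first exact: finite_measure_integrable_cst.
rewrite integral_cst// [X in (_ * X)%E](_ : _ = 1%E) ?mule1//.
exact: probability_setT.
Qed.

Lemma mean_le_sum (d0 : measure_display) (Omega : measurableType d0)
    (R : realType) (P : probability Omega R) (n : nat)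
    (f : 'I_n -> Omega -> R) (v : 'I_n -> R) :
  (forall i, mean_le P (f i) (v i)) ->
  mean_le P (fun w => \sum_(i < n) f i w) (\sum_(i < n) v i).
Proof.
elim: n f v => [|n IH] f v h.
  rewrite big_ord0 (_ : (fun w => _) = (fun=> 0)); first exact: mean_le_cst.
  by apply/funext => w; rewrite big_ord0.
rewrite big_ord_recr /= (_ : (fun w => _) = (fun w =>
   \sum_(i < n) f (widen_ord (leqnSn n) i) w + f ord_max w)); last first.
  by apply/funext => w; rewrite big_ord_recr.
by apply: mean_leD; [apply: IH => i|]; apply: h.
Qed.

(** Meant for [h] the error [Err], a supremum over a possibly uncountable set whose measurability is
    not established: the integral of a nonnegative function is a supremum over simple functions
    below it, hence monotone. *)
Lemma mean_le_bound (d0 : measure_display) (Omega : measurableType d0)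
    (R : realType) (P : probability Omega R) (h f : Omega -> R) (v : R) :
  (forall w, 0 <= h w <= f w) -> mean_le P f v ->
  (\int[P]_w (h w)%:E <= v%:E)%E.
Proof.
move=> hf [_ fv]; apply: le_trans fv.
have h0 w : 0 <= h w by case/andP: (hf w).
have f0 w : 0 <= f w by case/andP: (hf w) => /le_trans; apply.
rewrite !ge0_integralTE//.
apply: le_ereal_sup => _ /= [g gh <-]; exists g => // w.
by apply: le_trans (gh w) _; rewrite lee_fin; case/andP: (hf w).
Qed.

Lemma mean_le_comp (d0 : measure_display) (Omega : measurableType d0)
    (R : realType) (P : probability Omega R) (S : finType) (path : Omega -> S)
    (f : S -> R) :
  (forall a, measurable [set w | path w = a]) ->
  mean_le P (f \o path) (fexp (fun a => fine (P [set w | path w = a])) f).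
Proof.
move=> mp; set A := fun a => [set w | path w = a].
have -> : f \o path = (fun w => \sum_a f a * \1_(A a) w).
  apply/funext => w; rewrite (bigD1 (path w)) //= indicE mem_set// mulr1.
  rewrite big1 ?addr0// => a aw; rewrite indicE memNset ?mulr0//.
  by move=> /= h; rewrite h eqxx in aw.
have iA a : P.-integrable setT (fun w => (f a)%:E * (\1_(A a) w)%:E)%E.
  by apply: integrableZl => //; apply: integrable_indic; apply: mp.
have E w : (\sum_a f a * \1_(A a) w)%:E = (\sum_a (f a)%:E * (\1_(A a) w)%:E)%E.
  by rewrite -sumEFin; apply: eq_bigr => a _; rewrite EFinM.
split.
  rewrite (_ : _ \o _ = (fun w => \sum_a (f a)%:E * (\1_(A a) w)%:E)%E).
    by apply: integrable_sum.
  by apply/funext => w /=; rewrite E.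
under eq_integral do rewrite E.
rewrite integral_sum// /fexp -sumEFin; apply: lee_sum => a _.
rewrite integralZl//; last by apply: integrable_indic; apply: mp.
rewrite integral_indic//; last exact: mp.
rewrite setIT EFinM fineK 1?muleC//; exact: fin_num_measure.
Qed.

Lemma sum_fine_prob (d0 : measure_display) (Omega : measurableType d0)
    (R : realType) (P : probability Omega R) (S : finType) (path : Omega -> S) :
  (forall a, measurable [set w | path w = a]) ->
  \sum_a fine (P [set w | path w = a]) = 1.
Proof.
move=> mp; have one (c : R) := (mean_le_comp P (fun=> c) mp).2.
have cE (c : R) : (\int[P]_w (((fun=> c) \o path) w)%:E = c%:E)%E.
  rewrite /= integral_cst// [X in (_ * X)%E](_ : _ = 1%E) ?mule1//.
  exact: probability_setT.
(* The constants 1 and -1 turn the one-sided bound into an equality. *)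
have := one 1; have := one (-1); rewrite !cE !lee_fin /fexp -!mulr_suml; lra.
Qed.

(* The summand of the class of [a] is weighted by the inverse size of the class,
   so that summing over all [a] counts each class once. *)
Lemma mean_le_adapted0 (d0 : measure_display) (Omega : measurableType d0)
    (R : realType) (P : probability Omega R) (S : finType) (path : Omega -> S)
    (r : rel S) (f : S -> R) (xi : Omega -> R) :
  equivalence_rel r -> adapted r f ->
  (forall a, measurable [set w | r a (path w)]) ->
  P.-integrable setT (EFin \o xi) ->
  (forall a, \int[P]_(w in [set w | r a (path w)]) (xi w)%:E = 0)%E ->
  mean_le P (fun w => f (path w) * xi w) 0.
Proof.
move=> er af mA ixi xi0; set A := fun a => [set w | r a (path w)].
have rC := equivalence_rel_sym er.
have rE a b c : r a b -> r a c = r b c by have [_] := er a b c.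
pose k a := f a / #|[pred b | r a b]|%:R.
have E w : (f (path w) * xi w)%:E =
    (\sum_a (k a)%:E * ((EFin \o xi) \_ (A a)) w)%E.
  transitivity (\sum_(a | r (path w) a) ((k (path w)) * xi w)%:E)%E.
    rewrite sumEFin sumr_const -mulr_natl /k; congr (_%:E).
    rewrite mulrA; congr (_ * _); rewrite mulrC divfK// pnatr_eq0 -lt0n.
    apply/card_gt0P; exists (path w); rewrite inE.
    by have [] := er (path w) (path w) (path w).
  rewrite [RHS](bigID (r (path w))) /= [X in (_ + X)%E]big1 ?adde0.
    apply: eq_bigr => a ra; rewrite patchE mem_set /A /= 1?rC// EFinM.
    congr (_%:E * _)%E; rewrite /k (af _ _ ra); congr (_ / _%:R).
    by apply: eq_card => b; rewrite !inE (rE _ _ _ ra).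
  move=> a ra; rewrite patchE memNset ?mule0// /A /= rC.
  exact/negP.
have iA a : P.-integrable setT (fun w => (k a)%:E * ((EFin \o xi) \_ (A a)) w)%E.
  apply: integrableZl => //; apply/(integrable_mkcond _ (mA a)).
  exact: (integrableS measurableT (mA a) (@subsetT _ _) ixi).
split.
  rewrite (_ : _ \o _ = (fun w => \sum_a (k a)%:E * ((EFin \o xi) \_ (A a)) w)%E).
    by apply: integrable_sum.
  by apply/funext => w /=; rewrite E.
under eq_integral do rewrite E.
rewrite integral_sum// big1// => a _; rewrite integralZl//; last first.
  apply/(integrable_mkcond _ (mA a)).
  exact: (integrableS measurableT (mA a) (@subsetT _ _) ixi).
by rewrite -integral_mkcond xi0 mule0.
Qed.

Lemma mean_le_sqr (d0 : measure_display) (Omega : measurableType d0)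
    (R : realType) (P : probability Omega R) (d : nat)
    (xi : Omega -> 'rV[R]_d) (v : R) :
  (forall i, measurable_fun setT (fun w => xi w ord0 i)) ->
  (\int[P]_w (enorm (xi w) ^+ 2)%:E <= v%:E)%E ->
  mean_le P (fun w => \sum_i xi w ord0 i ^+ 2) v.
Proof.
move=> mxi.
have E w : enorm (xi w) ^+ 2 = \sum_i xi w ord0 i ^+ 2.
  rewrite /enorm sqr_sqrtr; first by apply: eq_bigr => i _; rewrite /vcoord expr2.
  by apply: sumr_ge0 => i _; rewrite -expr2 sqr_ge0.
under eq_integral do rewrite E.
move=> h; split => //; apply/integrableP; split.
  apply/measurable_EFinP; apply: measurable_sum => i.
  by apply: measurable_funX; apply: mxi.
apply: le_lt_trans (ltry v); apply: le_trans h.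
rewrite le_eqVlt; apply/orP; left; apply/eqP.
apply: eq_integral => w _ /=; rewrite ger0_norm//.
by apply: sumr_ge0 => i _; rewrite sqr_ge0.
Qed.

Lemma hist_sigma_measurable (d0 : measure_display) (Omega : measurableType d0)
    (R : realType) (d : nat) (x : nat -> Omega -> 'rV[R]_d) (t : nat) :
  (forall t (i : 'I_d), measurable_fun setT (fun w => vcoord (x t w) i)) ->
  hist_sigma x t `<=` measurable.
Proof.
move=> mx; apply: smallest_sub; first exact: sigma_algebra_measurable.
move=> _ [s [i [B [_ mB ->]]]].
by have := mx s i measurableT B mB; rewrite setTI.
Qed.

Lemma hist_sigma_cell (d0 : measure_display) (Omega : measurableType d0)
    (R : realType) (d : nat) (x : nat -> Omega -> 'rV[R]_d) (t N : nat)
    (x0 lo : 'rV[R]_d) (delta : R) (a : nat -> {ffun 'I_d * 'I_N -> bool}) :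
  (forall w, x 0%N w = x0) ->
  hist_sigma x t
    [set w | forall s, (s <= t)%N -> grid N lo delta (x s w) = a s].
Proof.
move=> x00.
pose C s ij := [set w | (lo ord0 ij.1 + (ij.2 : 'I_N)%:R * delta <= x s w ord0 ij.1)
                         = a s ij].
have -> : [set w | forall s, (s <= t)%N -> grid N lo delta (x s w) = a s] =
    \bigcap_(s in `I_t.+1) \bigcap_(ij in [set: 'I_d * 'I_N]) C s ij.
  apply/seteqP; split => [w /= h s st ij _|w h s st].
    by rewrite /C /= -h// ffunE.
  by apply/ffunP => ij; rewrite ffunE; apply: (h s st ij).
suff mC s ij : (s <= t)%N ->
    @measurable _ (g_sigma_algebraType (hist_gen x t)) (C s ij).
  change (@measurable _ (g_sigma_algebraType (hist_gen x t))
    (\bigcap_(s in `I_t.+1) \bigcap_(ij in [set: 'I_d * 'I_N]) C s ij)).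
  apply: fin_bigcap_measurable; first exact: finite_II.
  move=> s st; apply: fin_bigcap_measurable; first exact: finite_finset.
  by move=> ij _; apply: mC.
(* [hist_gen] starts at time 1, but [x 0] is deterministic, so its events are trivial. *)
case: s => [_|s st].
  have [h|h] := pselect ((lo ord0 ij.1 + (ij.2 : 'I_N)%:R * delta <= x0 ord0 ij.1)
                         = a 0%N ij).
    rewrite (_ : C _ _ = setT); first exact: measurableT.
    by apply/seteqP; split => // w _; rewrite /C /= x00.
  rewrite (_ : C _ _ = set0); first exact: measurable0.
  by apply/seteqP; split => // w; rewrite /C /= x00.
apply: sub_sigma_algebra; exists s.+1, ij.1.
exists [set r | (lo ord0 ij.1 + (ij.2 : 'I_N)%:R * delta <= r) = a s.+1 ij].
split => //.
set c := _ + _; case: (a s.+1 ij).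
  rewrite (_ : [set _ | _] = [set` `[c, +oo[]); first exact: measurable_itv.
  by apply/seteqP; split => r /=; rewrite in_itv/= andbT.
rewrite (_ : [set _ | _] = [set` `]-oo, c[]); first exact: measurable_itv.
apply/seteqP; split => r /=; rewrite in_itv/= ltNge; first by move=> ->.
by move/negbTE.
Qed.

(** * The comparator martingale *)

(* Conditioning [y - x0] rather than [y] makes the value on a null class equal to
   [x0], hence still feasible. *)
Definition comp_mart (R : realType) (d : nat) (S : finType) (p : S -> R)
    (r : nat -> rel S) (x0 : 'rV[R]_d) (y : S -> 'rV[R]_d) (t : nat) (a : S)
    : 'rV[R]_d :=
  \row_i (x0 ord0 i + cexp p (r t) (fun b => y b ord0 i - x0 ord0 i) a).

Lemma comp_mart_mem (R : realType) (d : nat) (X : set 'rV[R]_d) (S : finType)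
    (p : S -> R) (r : nat -> rel S) (x0 : 'rV[R]_d) (y : S -> 'rV[R]_d) t a :
  convex_set X -> X x0 -> (forall b, X (y b)) -> (forall b, 0 <= p b) ->
  X (comp_mart p r x0 y t a).
Proof.
move=> cX Xx0 Xy p0; set W := \sum_(b | r t a b) p b.
have [W0|Wn0] := eqVneq W 0.
  rewrite (_ : comp_mart _ _ _ _ _ _ = x0)//; apply/rowP => i.
  by rewrite mxE /cexp -/W W0 invr0 mulr0 addr0.
have Wgt0 : 0 < W by rewrite lt0r Wn0 sumr_ge0.
have := convex_set_sum cX p0 Xy Wgt0; rewrite -/W.
rewrite (_ : _ *: _ = comp_mart p r x0 y t a)//; apply/rowP => i.
rewrite !mxE summxE /cexp -/W.
under eq_bigr do rewrite mxE.
under [in RHS]eq_bigr do rewrite mulrBr.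
by rewrite sumrB -mulr_suml -/W; field.
Qed.

Lemma comp_mart_adapted (R : realType) (d : nat) (S : finType)
    (p : S -> R) (r : nat -> rel S) (x0 : 'rV[R]_d) (y : S -> 'rV[R]_d) t i :
  equivalence_rel (r t) -> adapted (r t) (fun a => comp_mart p r x0 y t a ord0 i).
Proof.
by move=> er a b rab; rewrite !mxE (cexp_adapted _ _ er rab).
Qed.

Lemma comp_mart_tower (R : realType) (d : nat) (S : finType)
    (p : S -> R) (r : nat -> rel S) (x0 : 'rV[R]_d) (y : S -> 'rV[R]_d) t i
    (h : S -> R) :
  (forall b, 0 <= p b) -> equivalence_rel (r t) -> adapted (r t) h ->
  fexp p (fun a => h a * (comp_mart p r x0 y t a ord0 i - y a ord0 i)) = 0.
Proof.
move=> p0 er ah.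
have -> : fexp p (fun a => h a * (comp_mart p r x0 y t a ord0 i - y a ord0 i)) =
  fexp p (fun a => h a * cexp p (r t) (fun b => y b ord0 i - x0 ord0 i) a) +
  -1 * fexp p (fun a => h a * (y a ord0 i - x0 ord0 i)).
  by rewrite -fexpZ -fexpD; apply: eq_bigr => a _; rewrite mxE; ring.
by rewrite fexp_cexp//; ring.
Qed.

(** The transform has [H = 4 * eta] and [B = eta]. The squares of the three summands of [driftY]
    thus have means at most 25, 16 and 64 times [eta ^+ 4], and [3 * (25 + 16 + 64) = 315]. *)
Lemma driftY_second_moment (R : realType) (d : nat) (X : set 'rV[R]_d)
    (S : finType) (p : S -> R) (r : nat -> rel S) (x0 : 'rV[R]_d)
    (y : S -> 'rV[R]_d) (q : nat -> S -> 'rV[R]_d) (eta : R) (T : nat) i :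
  convex_set X -> X x0 -> (forall b, X (y b)) -> (forall t b, X (q t b)) ->
  (forall u v, X u -> X v -> infnorm (u - v) <= eta) ->
  (forall b, 0 <= p b) -> \sum_b p b = 1 ->
  (forall t, equivalence_rel (r t)) ->
  (forall t a b, r t.+1 a b -> r t a b) ->
  (forall t, adapted (r t) (fun a => q t a ord0 i)) ->
  fexp p (fun a => driftY eta x0 (q^~ a) ((comp_mart p r x0 y)^~ a) T i ^+ 2)
    <= 315 * eta ^+ 4.
Proof.
move=> cX Xx0 Xy Xq Xeta p0 p1 er rS aq.
have Xinf u v := @coord_dist_le _ _ _ _ u v i Xeta.
pose ys := comp_mart p r x0 y.
have Xys t a : X (ys t a) := comp_mart_mem r t a cX Xx0 Xy p0.
pose f b := y b ord0 i - x0 ord0 i.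
pose h t a := (ys t a ord0 i - q t a ord0 i) - 3 * (ys t a ord0 i - x0 ord0 i).
have ah t : adapted (r t) (h t).
  move=> a b rab; rewrite /h (aq t a b rab).
  by rewrite (comp_mart_adapted p x0 y i (er t) rab).
have fB b : `|f b| <= eta by apply: Xinf.
have hH t a : `|h t a| <= 4 * eta.
  apply: le_trans (ler_normB _ _) _; rewrite normrM ger0_norm//.
  have := Xinf _ _ (Xys t a) (Xq t a); have := Xinf _ _ (Xys t a) Xx0; lra.
have [] := mtransf_bound T p0 p1 er rS ah fB hH.
set m := mtransf _ _ => m2 M2.
have mE n a : drift x0 (q^~ a) (ys^~ a) i n = m n a.
  by apply: eq_bigr => t _; congr (_ * _); rewrite !mxE; ring.
have e2 : (4 * eta) ^+ 2 * eta ^+ 2 = 16 * eta ^+ 4 by ring.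
rewrite e2 in m2 M2.
have c2 : fexp p (fun=> (5 * eta ^+ 2) ^+ 2) = 25 * eta ^+ 4.
  by rewrite /fexp -mulr_suml p1; ring.
apply: (@le_trans _ _ (3 * (fexp p (fun=> (5 * eta ^+ 2) ^+ 2) +
   fexp p (fun a => m T a ^+ 2) +
   fexp p (fun a => runmax (fun s => - m s a) T ^+ 2)))); last by rewrite c2; lra.
rewrite -!fexpD -fexpZ; apply: ler_fexp => // a; rewrite /driftY mE.
have -> : (fun n => - drift x0 (q^~ a) (ys^~ a) i n) = (fun n => - m n a).
  by apply/funext => n; rewrite mE.
move: (5 * eta ^+ 2) (m T a) (runmax _ _) => A B C.
have := sqr_ge0 (A - B); have := sqr_ge0 (A - C); have := sqr_ge0 (B - C); nra.
Qed.

Definition agree (T : nat) (K : finType) (t : nat) : rel {ffun 'I_T.+1 -> K} :=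
  fun a b => [forall s : 'I_T.+1, (s <= t)%N ==> (a s == b s)].

Lemma agreeP (T : nat) (K : finType) (t : nat) (a b : {ffun 'I_T.+1 -> K}) :
  reflect (forall s : 'I_T.+1, (s <= t)%N -> a s = b s) (agree t a b).
Proof.
by apply: (iffP forallP) => h s; [move/implyP: (h s) => + st => /(_ st)/eqP
                                 |apply/implyP => st; rewrite h].
Qed.

Lemma agree_equiv (T : nat) (K : finType) (t : nat) :
  equivalence_rel (@agree T K t).
Proof.
move=> a b c; split; first by apply/agreeP.
move=> /agreeP ab; apply/agreeP/agreeP => h s st; first by rewrite -ab// h.
by rewrite ab// h.
Qed.

Lemma agreeS (T : nat) (K : finType) (t : nat) (a b : {ffun 'I_T.+1 -> K}) :
  agree t.+1 a b -> agree t a b.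
Proof. by move/agreeP => h; apply/agreeP => s st; apply/h/leqW. Qed.

(** * The averaged iterate and the bound in expectation *)

Lemma average_mem (R : realType) (d : nat) (X : set 'rV[R]_d) (T : nat)
    (x : nat -> 'rV[R]_d) :
  convex_set X -> (0 < T)%N -> (forall t, (0 < t <= T)%N -> X (x t)) ->
  X (T%:R^-1 *: \sum_(1 <= t < T.+1) x t).
Proof.
move=> cX T0 Xx; rewrite big_add1 big_mkord /=.
have := @convex_set_sum R d X 'I_T xpredT (fun=> 1) (fun t => x t.+1) cX.
rewrite /= sumr_const card_ord.
rewrite (eq_bigr (fun t : 'I_T => x t.+1)); last by move=> t _; rewrite scale1r.
by apply => //; [move=> t; apply: Xx; exact: ltn_ord|rewrite ltr0n].
Qed.

(** Testing with [x] itself gives nonnegativity, which [mean_le_bound] requires. *)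
Lemma Err_bounds (R : realType) (d : nat) (X : set 'rV[R]_d)
    (F : 'rV[R]_d -> 'rV[R]_d) (x : 'rV[R]_d) (M : R) :
  X x -> (forall u, X u -> dotp (F u) (x - u) <= M) -> 0 <= Err X F x <= M.
Proof.
move=> Xx h; apply/andP; split.
  apply: ub_le_sup; first by exists M => _ [u Xu <-]; apply: h.
  by exists x => //; rewrite dotpB big1// => i _; rewrite subrr mulr0.
apply: ge_sup; first by exists (dotp (F x) (x - x)); exists x.
by move=> _ [u Xu <-]; apply: h.
Qed.

Lemma dotp_average (R : realType) (d : nat) (T : nat) (a u : 'rV[R]_d)
    (x : nat -> 'rV[R]_d) :
  (0 < T)%N ->
  dotp a (T%:R^-1 *: \sum_(1 <= t < T.+1) x t - u) =
  T%:R^-1 * \sum_(t < T) dotp a (x t.+1 - u).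
Proof.
move=> T0; have TR : T%:R != 0 :> R by rewrite pnatr_eq0 -lt0n.
rewrite big_add1 big_mkord /= dotpB.
under [in RHS]eq_bigr do rewrite dotpB.
rewrite [in RHS]exchange_big mulr_sumr /=; apply: eq_bigr => i _.
rewrite -mulr_sumr sumrB sumr_const card_ord -mulr_natl !mxE summxE.
by field.
Qed.

(** [lam] is the Young weight of the noise and [e] the total quantization error. From the second
    moment 315: [g0] gets [(315 + 1) / 2 = 158], [1 / lam] gets [315 / 2], rounded up to 158, and
    [beta] gets [2 * 315] plus [1 / 4] from the first step, rounded up to 631. *)
Lemma expected_err_le (R : realType) (d : nat) (X : set 'rV[R]_d) (eta : R)
    (beta : 'rV[R]_d) (F : 'rV[R]_d -> 'rV[R]_d) (sigma g0 : R) (T : nat)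
    (d0 : measure_display) (Omega : measurableType d0) (P : probability Omega R)
    (G x z : nat -> Omega -> 'rV[R]_d) (x0 : 'rV[R]_d) (lam e : R) :
  X x0 -> convex_set X ->
  (forall u v, X u -> X v -> infnorm (u - v) <= eta) -> 0 < eta ->
  (forall i, 0 < vcoord beta i) ->
  (forall u v, X u -> X v ->
     wnorm2 (vinv beta) (F u - F v) <= dotp (F u - F v) (u - v)) ->
  0 <= g0 -> (0 < T)%N ->
  (forall t (i : 'I_d), measurable_fun setT (fun w => vcoord (x t w) i)) ->
  (forall t (i : 'I_d), (t <= T)%N ->
     P.-integrable setT (fun w => (vcoord (G t w - F (x t w)) i)%:E)) ->
  (forall t (i : 'I_d) (A : set Omega), (t <= T)%N -> hist_sigma x t A ->
     (\int[P]_(w in A) (vcoord (G t w - F (x t w)) i)%:E = 0)%E) ->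
  (forall t, (t <= T)%N ->
     (\int[P]_w (enorm (G t w - F (x t w)) ^+ 2)%:E <= (sigma ^+ 2)%:E)%E) ->
  (forall w, x 0%N w = x0 /\ z 0%N w = x0) ->
  (forall w t, (0 < t <= T)%N ->
     is_argmin X (fun u => dotp (G t.-1 w) u
        + 2^-1 * wnorm2 (Dstep g0 eta (G^~ w) t.-1) (u - z t.-1 w)) (x t w)
     /\
     is_argmin X (fun u => dotp (G t w) u
        + 2^-1 * wnorm2 (Dstep g0 eta (G^~ w) t.-1) (u - z t.-1 w)
        + 2^-1 * wnorm2 (Dstep g0 eta (G^~ w) t - Dstep g0 eta (G^~ w) t.-1)
                        (u - x t w)) (z t w)) ->
  0 < lam -> 0 < e ->
  (\int[P]_w (Err X F ((T%:R)^-1 *: \sum_(1 <= t < T.+1) x t w))%:E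
     <= (631 * ((trace_diag beta + g0 * d%:R) * eta ^+ 2 / T%:R)
         + (4 * sigma ^+ 2) * lam + (158 * (d%:R * eta ^+ 2) / T%:R) / lam
         + e)%:E)%E.
Proof.
move=> Xx0 cX Xeta eta0 b0 coco g00 T0 mx ixi xi0 xi2 xz0 alg lam0 e0.
have TR : 0 < T%:R :> R by rewrite ltr0n.
have t0 := trace_diag_ge0 b0.
(* Three exchanges with the net ([s1], [s2], [s4]) use half of [e]. *)
pose e1 := e / 6; have e10 : 0 < e1 by rewrite divr_gt0.
have [delta0 delta00 gapc] := gap_continuous Xx0 eta0 Xeta b0 coco e10.
have ds0 : 0 < 2 * (d%:R + sigma ^+ 2 + 1) :> R.
  by rewrite mulr_gt0// ltr_pwDr// addr_ge0// sqr_ge0.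
(* The three bounds serve [gap], the tolerance [eta / T] of [path_err], and the other half of [e],
   spent in [s5] on the noise against [q - x]. *)
pose delta := Num.min delta0 (Num.min (eta / T%:R) (e / (2 * (d%:R + sigma ^+ 2 + 1)))).
have dl0 : 0 < delta by rewrite !lt_min delta00 !divr_gt0.
have dl1 : delta <= delta0 by rewrite ge_min lexx.
have dl2 : delta <= eta / T%:R by rewrite !ge_min lexx orbT.
have dl3 : delta * (d%:R + sigma ^+ 2) <= e / 2.
  have : delta <= e / (2 * (d%:R + sigma ^+ 2 + 1)) by rewrite !ge_min lexx !orbT.
  rewrite ler_pdivlMr//; lra.
have dl01 : 0 < delta <= delta0 by rewrite dl0.
have {gapc} gap := gapc delta dl01.
have [N [lo [rep [Xrep repc]]]] := quantization Xx0 dl0 Xeta.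
have refl (u : 'rV[R]_d) i : `|u ord0 i - u ord0 i| <= delta.
  by rewrite subrr normr0 ltW.
have repc' v i : X v -> `|v ord0 i - rep (grid N lo delta v) ord0 i| <= delta.
  by move=> Xv; rewrite distrC repc.
pose K : finType := {ffun 'I_d * 'I_N -> bool}.
pose S : finType := {ffun 'I_T.+1 -> K}.
pose path w : S := [ffun s : 'I_T.+1 => grid N lo delta (x s w)].
pose r (t : nat) : rel S := @agree T K t.
have er t : equivalence_rel (r t) by apply: agree_equiv.
have rS t a b : r t.+1 a b -> r t a b by apply: agreeS.
have cell t (a : S) : (t <= T)%N -> hist_sigma x t [set w | r t a (path w)].
  move=> tT; have := @hist_sigma_cell _ _ _ _ x t N x0 lo delta
    (fun s => a (inord s)) (fun w => (xz0 w).1).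
  congr (hist_sigma x t _); apply/seteqP; split => [w /= h|w /agreeP h s st].
    apply/agreeP => s st; rewrite ffunE; have := h s st.
    by rewrite inord_val.
  have sT : (s < T.+1)%N by rewrite ltnS (leq_trans st).
  by rewrite h ?inordK// ffunE inordK.
have mcell t a : (t <= T)%N -> measurable [set w | r t a (path w)].
  by move=> tT; apply: (hist_sigma_measurable mx (cell t a tT)).
have mpath a : measurable [set w | path w = a].
  rewrite (_ : [set _ | _] = [set w | r T a (path w)]); first exact: mcell.
  apply/seteqP; split => [w /= ->|w /agreeP h]; first exact/agreeP.
  by apply/ffunP => s; rewrite h// -ltnS.
pose p a := fine (P [set w | path w = a]).
have p0 a : 0 <= p a by apply: fine_ge0.
have p1 : \sum_a p a = 1 by apply: sum_fine_prob.
(* For [t > T], [inord t] is 0, so [q] is adapted at all times. *)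
pose q t (a : S) := rep (a (inord t)).
have Xq t a : X (q t a) by apply: Xrep.
have aq t (f : 'rV[R]_d -> R) : adapted (r t) (fun a => f (q t a)).
  move=> a b /agreeP h; rewrite /q h//; have [tT|tT] := leqP t T.
    by rewrite inordK.
  by rewrite /inord /insubd insubF//= ltnNge tT.
(* The comparator is the best net point for the quantized run. It depends on the whole path, hence
   the projection to [ys]. *)
pose gap_sum (a : S) k := \sum_(t < T) dotp (F (rep k)) (q t.+1 a - rep k).
pose kmax a := [arg max_(k > grid N lo delta x0) gap_sum a k]%O.
pose y a := rep (kmax a).
have Xy a : X (y a) by apply: Xrep.
have ymax a k : gap_sum a k <= gap_sum a (kmax a).
  by rewrite /kmax; case: arg_maxP => // k0 _; apply.
pose ys := comp_mart p r x0 y.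
have Xys t a : X (ys t a) := comp_mart_mem r t a cX Xx0 Xy p0.
pose xi t w := G t w - F (x t w).
pose Y a := driftY eta x0 (q^~ a) (ys^~ a) T.
pose Z a i := g0 * (2^-1 * (Y a i ^+ 2 / eta ^+ 2 + eta ^+ 2))
         + 2 * beta ord0 i * (Y a i ^+ 2 / eta ^+ 2)
         + (2 * lam)^-1 * (Y a i ^+ 2 / eta ^+ 2).
pose Nx t w := \sum_i xi t w ord0 i ^+ 2.
pose fS a := \sum_(t < T) \sum_i F (q t.+1 a) ord0 i *
     (ys t.+1 a ord0 i - y a ord0 i) + \sum_i Z a i.
pose c0 := T%:R * (3 * e1 + d%:R * delta) + 4^-1 * (trace_diag beta * eta ^+ 2).
(* A single majorant independent of the test point, so that it bounds the supremum in [Err]. *)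
pose Psi w := c0 + fS (path w)
  + \sum_(t < T) \sum_i (ys t.+1 (path w) ord0 i - q t.+1 (path w) ord0 i)
       * xi t.+1 w ord0 i
  + \sum_(t < T) ((delta + 2 * lam) * Nx t.+1 w + (2 * lam) * Nx t w).
have Xx w t : (t <= T)%N -> X (x t w).
  by case: t => [_|t tT]; [rewrite (xz0 w).1|case: (alg w t.+1 tT) => -[]].
have qpath t w : (t <= T)%N -> q t (path w) = rep (grid N lo delta (x t w)).
  by move=> tT; rewrite /q ffunE inordK.
have pathwise w u : X u -> \sum_(t < T) dotp (F u) (x t.+1 w - u) <= Psi w.
  move=> Xu; set a := path w.
  have s1 : \sum_(t < T) dotp (F u) (x t.+1 w - u) <=
      gap_sum a (grid N lo delta u) + T%:R * e1.
    rewrite mulr_natl -[in e1 *+ T](card_ord T) -sumr_const -big_split /=.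
    apply: ler_sum => t _; rewrite qpath//.
    by apply: gap => //; try (by move=> i; apply: repc' => //; apply: Xx); apply: Xx.
  have s2 : gap_sum a (kmax a) <=
      \sum_(t < T) dotp (F (y a)) (x t.+1 w - y a) + T%:R * e1.
    rewrite mulr_natl -[in e1 *+ T](card_ord T) -sumr_const -big_split /=.
    apply: ler_sum => t _; rewrite qpath//.
    by apply: gap => //; try (by move=> i; apply: repc => //; apply: Xx); apply: Xx.
  have qx t i : (t <= T)%N -> `|q t a ord0 i - x t w ord0 i| <= eta / T%:R.
    move=> tT; rewrite qpath//; apply: le_trans dl2; apply: repc; exact: Xx.
  have s3 := path_err cX Xx0 eta0 Xeta b0 coco g00 lam0 T0 (xz0 w).1 (xz0 w).2
    (alg w) (Xy a) (fun t _ => Xys t a) qx.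
  have s4 : \sum_(t < T) dotp (F (x t.+1 w)) (ys t.+1 a - y a) <=
      \sum_(t < T) \sum_i F (q t.+1 a) ord0 i *
       (ys t.+1 a ord0 i - y a ord0 i) + T%:R * e1.
    rewrite mulr_natl -[in e1 *+ T](card_ord T) -sumr_const -big_split /=.
    apply: ler_sum => t _; rewrite -dotpB qpath//.
    by apply: gap => //; try (by move=> i; apply: repc' => //; apply: Xx); apply: Xx.
  (* With [q] in place of [x], the factor of the noise is constant on the cells, over each of which
     the noise integrates to zero. *)
  have s5 : - \sum_(t < T) dotp (xi t.+1 w) (x t.+1 w - ys t.+1 a) <=
      \sum_(t < T) \sum_i (ys t.+1 a ord0 i - q t.+1 a ord0 i)
       * xi t.+1 w ord0 i + \sum_(t < T) delta * Nx t.+1 w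
       + T%:R * (d%:R * delta).
    rewrite [T%:R * _]mulr_natl -[in _ *+ T](card_ord T) -sumr_const.
    rewrite -!big_split /= -sumrN; apply: ler_sum => t _.
    rewrite mulr_natl -[in _ *+ d](card_ord d) -sumr_const mulr_sumr.
    rewrite -!big_split /= dotpB -sumrN; apply: ler_sum => i _.
    have : `|q t.+1 a ord0 i - x t.+1 w ord0 i| <= delta.
      by rewrite qpath//; apply: repc; apply: Xx.
    move: (xi _ _ _ _) (q _ _ _ _) (x _ _ _ _) (ys _ _ _ _) => b q' x' y' qx'.
    have : (q' - x') * b <= delta * (b ^+ 2 + 1).
      apply: le_trans (ler_norm _) _; rewrite normrM; apply: ler_pM => //.
      have := sqr_ge0 (`|b| - 1); rewrite sqrrB1 real_normK ?num_real//.
      have := sqr_ge0 b; lra.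
    lra.
  have s6 : lam * \sum_(t < T) \sum_i
      (2 * xi t.+1 w ord0 i ^+ 2 + 2 * xi t w ord0 i ^+ 2) =
      \sum_(t < T) (2 * lam * Nx t.+1 w + 2 * lam * Nx t w).
    rewrite mulr_sumr; apply: eq_bigr => t _.
    by rewrite big_split /= -!mulr_sumr /Nx; ring.
  have s7 : \sum_(t < T) ((delta + 2 * lam) * Nx t.+1 w + (2 * lam) * Nx t w) =
     \sum_(t < T) delta * Nx t.+1 w +
     \sum_(t < T) (2 * lam * Nx t.+1 w + 2 * lam * Nx t w).
    by rewrite -big_split /=; apply: eq_bigr => t _; ring.
  have s8 := ymax a (grid N lo delta u).
  rewrite /Psi -/a /fS s7 -s6 /c0.
  rewrite -/(xi _ _) in s3.
  move: s3; rewrite -/(Y a) -/(Z a _).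
  lra.
have e2 : eta ^+ 2 != 0 by rewrite sqrf_eq0 gt_eqF.
have meanY i : fexp p (fun a => Y a i ^+ 2 / eta ^+ 2) <= 315 * eta ^+ 2.
  have -> : fexp p (fun a => Y a i ^+ 2 / eta ^+ 2) =
      (eta ^+ 2)^-1 * fexp p (fun a => Y a i ^+ 2).
    by rewrite -fexpZ; apply: eq_bigr => a _; congr (_ * _); rewrite mulrC.
  rewrite mulrC ler_pdivrMr ?exprn_gt0//.
  have -> : 315 * eta ^+ 2 * eta ^+ 2 = 315 * eta ^+ 4 by ring.
  exact: (driftY_second_moment T cX Xx0 Xy Xq Xeta p0 p1 er rS
    (fun t => aq t (fun v => v ord0 i))).
have meanZ i : fexp p (fun a => Z a i) <= 158 * (g0 * eta ^+ 2)
    + 630 * (beta ord0 i * eta ^+ 2) + 158 * (lam^-1 * eta ^+ 2).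
  have -> : fexp p (fun a => Z a i) = (2^-1 * g0 + 2 * beta ord0 i + (2 * lam)^-1) *
      fexp p (fun a => Y a i ^+ 2 / eta ^+ 2) + fexp p (fun=> 2^-1 * g0 * eta ^+ 2).
    by rewrite -fexpZ -fexpD; apply: eq_bigr => a _; rewrite /Z; congr (_ * _); ring.
  have -> : fexp p (fun=> 2^-1 * g0 * eta ^+ 2) = 2^-1 * g0 * eta ^+ 2.
    by rewrite /fexp -mulr_suml p1 mul1r.
  have bi : 0 < beta ord0 i := b0 i.
  have k0 : 0 <= 2^-1 * g0 + 2 * beta ord0 i + (2 * lam)^-1.
    rewrite addr_ge0 ?invr_ge0 ?mulr_ge0 ?(ltW lam0)// addr_ge0//.
      by rewrite mulr_ge0.
    by rewrite mulr_ge0// ltW.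
  apply: le_trans (lerD (ler_wpM2l k0 (meanY i)) (lexx _)) _.
  have il : 0 <= lam^-1 * eta ^+ 2 by rewrite mulr_ge0 ?sqr_ge0// invr_ge0 ltW.
  rewrite invfM; lra.
have meanS : fexp p fS <= \sum_i (158 * (g0 * eta ^+ 2)
    + 630 * (beta ord0 i * eta ^+ 2) + 158 * (lam^-1 * eta ^+ 2)).
  rewrite fexpD !fexp_sum big1 ?add0r; first by apply: ler_sum => i _; apply: meanZ.
  move=> t _; rewrite fexp_sum big1// => i _.
  by apply: comp_mart_tower => //; apply: (aq t.+1 (fun v => F v ord0 i)).
have ixi' t i : (t <= T)%N -> P.-integrable setT (EFin \o (fun w => xi t w ord0 i)).
  exact: ixi.
have meanN t : (t <= T)%N -> mean_le P (Nx t) (sigma ^+ 2).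
  move=> tT; apply: mean_le_sqr; last exact: xi2.
  by move=> i; have /integrableP[/measurable_EFinP] := ixi' t i tT.
have meanPsi : mean_le P Psi (c0 + \sum_i (158 * (g0 * eta ^+ 2)
    + 630 * (beta ord0 i * eta ^+ 2) + 158 * (lam^-1 * eta ^+ 2))
    + \sum_(t < T) \sum_(i < d) 0
    + \sum_(t < T) ((delta + 2 * lam) * sigma ^+ 2 + (2 * lam) * sigma ^+ 2)).
  apply: mean_leD; first apply: mean_leD; first apply: mean_leD.
  - exact: mean_le_cst.
  - by apply: mean_le_weaken meanS _; apply: mean_le_comp.
  - apply: mean_le_sum => t; apply: mean_le_sum => i.
    apply: (@mean_le_adapted0 _ _ _ P S path (r t.+1)
      (fun a => ys t.+1 a ord0 i - q t.+1 a ord0 i)) => //.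
    + move=> a b rab; rewrite (aq t.+1 (fun v => v ord0 i) a b rab).
      by rewrite (comp_mart_adapted p x0 y i (er t.+1) rab).
    + by move=> a; apply: mcell.
    + exact: ixi'.
    + by move=> a; apply: xi0 => //; apply: cell.
  - have l2 : 0 <= 2 * lam by rewrite mulr_ge0// ltW.
    apply: mean_le_sum => t; apply: mean_leD; apply: mean_leZ => //.
    + by rewrite addr_ge0// ltW.
    + exact: meanN.
    + by apply: meanN; apply: ltnW.
have iT : 0 <= (T%:R)^-1 :> R by rewrite invr_ge0 ltW.
apply: mean_le_bound; last first.
  apply: mean_le_weaken (mean_leZ iT meanPsi).
  rewrite [\sum_(t < T) \sum_(i < d) 0]big1 ?addr0; last first.
    by move=> t _; rewrite big1.
  have sc n (c : R) : \sum_(i < n) c = n%:R * c.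
    by rewrite sumr_const card_ord mulr_natl.
  have -> : \sum_i (158 * (g0 * eta ^+ 2) + 630 * (beta ord0 i * eta ^+ 2)
       + 158 * (lam^-1 * eta ^+ 2)) = 158 * (g0 * d%:R * eta ^+ 2)
       + 630 * (trace_diag beta * eta ^+ 2) + 158 * (d%:R * eta ^+ 2 / lam).
    by rewrite !big_split /= !sc -mulr_sumr -mulr_suml /trace_diag /vcoord; ring.
  rewrite sc /c0 /e1.
  have hd := divr_ge0 (mulr_ge0 (mulr_ge0 g00 (ler0n R d)) (sqr_ge0 eta)) (ltW TR).
  have ht := divr_ge0 (mulr_ge0 t0 (sqr_ge0 eta)) (ltW TR).
  rewrite [X in X <= _](_ : _ = e / 2 + delta * (d%:R + sigma ^+ 2)
    + 4 * sigma ^+ 2 * lam + 158 * (g0 * d%:R * eta ^+ 2 / T%:R)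
    + (630 + 4^-1) * (trace_diag beta * eta ^+ 2 / T%:R)
    + 158 * (d%:R * eta ^+ 2) / T%:R / lam); last by field; rewrite !gt_eqF.
  have -> : (trace_diag beta + g0 * d%:R) * eta ^+ 2 / T%:R =
    trace_diag beta * eta ^+ 2 / T%:R + g0 * d%:R * eta ^+ 2 / T%:R by ring.
  lra.
move=> w; apply: Err_bounds; first by apply: average_mem => // t /andP[_]; apply: Xx.
by move=> u Xu; rewrite dotp_average// ler_wpM2l// pathwise.
Qed.

(** The optimal [lam] is [b / a]. Shifting both by [s] keeps it positive when [a] or [b] is 0, at a
    cost [s * (a + b)] of at most [e / 2]. *)
Lemma le_inf_tradeoff (R : realType) (I K a b : R) :
  0 <= a -> 0 <= b ->
  (forall lam e, 0 < lam -> 0 < e ->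
     I <= K + a ^+ 2 * lam + b ^+ 2 / lam + e) ->
  I <= K + 2 * (a * b).
Proof.
move=> a0 b0 h; apply/ler_addgt0Pr => e e0.
pose s := e / (2 * (a + b + 1)).
have ab0 : 0 < 2 * (a + b + 1) by lra.
have s0 : 0 < s by rewrite divr_gt0.
have sE : s * (a + b) <= e / 2.
  have : s * (2 * (a + b + 1)) = e by rewrite divfK// gt_eqF.
  lra.
have as0 : 0 < a + s by lra.
have bs0 : 0 < b + s by lra.
have e20 : 0 < e / 2 by lra.
have := h ((b + s) / (a + s)) _ (divr_gt0 bs0 as0) e20.
have h1 : a ^+ 2 * ((b + s) / (a + s)) <= a * (b + s).
  rewrite mulrA ler_pdivrMr//; have := mulr_ge0 (mulr_ge0 a0 (ltW bs0)) (ltW s0); lra.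
have h2 : b ^+ 2 / ((b + s) / (a + s)) <= b * (a + s).
  rewrite invf_div mulrA ler_pdivrMr//.
  have := mulr_ge0 (mulr_ge0 b0 (ltW as0)) (ltW s0); lra.
lra.
Qed.
Unset Implicit Arguments.
Set Strict Implicit.
Set Printing Implicit Defensive.

Theorem theoremF14 (R : realType) :
  exists C : R, 0 < C /\
  forall (d : nat) (X : set 'rV[R]_d) (Rd Rinf : R) (beta : 'rV[R]_d)
    (F : 'rV[R]_d -> 'rV[R]_d) (sigma gamma0 : R) (T : nat)
    (d0 : measure_display) (Omega : measurableType d0) (P : probability Omega R)
    (G : nat -> Omega -> 'rV[R]_d) (x z : nat -> Omega -> 'rV[R]_d) (x0 : 'rV[R]_d),
  (* the feasible set *)
  X x0 -> closed X -> convex_set X -> bounded_set X ->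
  (* R = max_{x,y in X} ||x - y||,  R_inf >= max_{x,y in X} ||x - y||_inf *)
  (forall u v, X u -> X v -> enorm (u - v) <= Rd) ->
  (exists u v, [/\ X u, X v & enorm (u - v) = Rd]) ->
  (forall u v, X u -> X v -> infnorm (u - v) <= Rinf) ->
  (* eta = R_inf must be > 0 *)
  0 < Rinf ->
  (* B = diag(beta), beta_i > 0, F 1-cocoercive w.r.t. ||.||_B *)
  (forall i, 0 < vcoord beta i) ->
  (forall u v, X u -> X v ->
     wnorm2 (vinv beta) (F u - F v) <= dotp (F u - F v) (u - v)) ->
  0 <= sigma -> 0 <= gamma0 -> (0 < T)%N ->
  (* the oracle outputs G t = \hat F(x_t) and iterates are random vectors *)
  (forall t (i : 'I_d), measurable_fun setT (fun w => vcoord (G t w) i)) ->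
  (forall t (i : 'I_d), measurable_fun setT (fun w => vcoord (x t w) i)) ->
  (forall t (i : 'I_d), measurable_fun setT (fun w => vcoord (z t w) i)) ->
  (* stochastic oracle: E[\hat F(x_t) | x_1..x_t] = F(x_t) *)
  (forall t (i : 'I_d), (t <= T)%N ->
     P.-integrable setT (fun w => (vcoord (G t w - F (x t w)) i)%:E)) ->
  (forall t (i : 'I_d) (A : set Omega), (t <= T)%N -> hist_sigma x t A ->
     (\int[P]_(w in A) (vcoord (G t w - F (x t w)) i)%:E = 0)%E) ->
  (* E ||\hat F(x_t) - F(x_t)||^2 <= sigma^2 *)
  (forall t, (t <= T)%N ->
     (\int[P]_w (enorm (G t w - F (x t w)) ^+ 2)%:E <= (sigma ^+ 2)%:E)%E) ->
  (* Algorithm AdaPEG-Vector with eta = R_inf *)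
  (forall w, x 0%N w = x0 /\ z 0%N w = x0) ->
  (forall w t, (0 < t <= T)%N ->
     is_argmin X (fun u => dotp (G t.-1 w) u
        + 2^-1 * wnorm2 (Dstep gamma0 Rinf (G^~ w) t.-1) (u - z t.-1 w)) (x t w)
     /\
     is_argmin X (fun u => dotp (G t w) u
        + 2^-1 * wnorm2 (Dstep gamma0 Rinf (G^~ w) t.-1) (u - z t.-1 w)
        + 2^-1 * wnorm2 (Dstep gamma0 Rinf (G^~ w) t - Dstep gamma0 Rinf (G^~ w) t.-1)
                        (u - x t w)) (z t w)) ->
  (* conclusion: E[Err(xbar_T)] <= C ((tr B + gamma0 d) R_inf^2 / T
                                      + (sqrt d R_inf + R) sigma / sqrt T) *)
  (\int[P]_w (Err X F ((T%:R)^-1 *: \sum_(1 <= t < T.+1) x t w))%:E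
     <= (C * ((trace_diag beta + gamma0 * d%:R) * Rinf ^+ 2 / T%:R
              + (Num.sqrt d%:R * Rinf + Rd) * sigma / Num.sqrt T%:R))%:E)%E.
Proof.
exists 631; split; first by rewrite ltr0n.
move=> d X Rd eta beta F sigma g0 T d0 Omega P G x z x0
  Xx0 _ cX _ XR [u [v [_ _ Rduv]]] Xeta eta0 b0 coco sg0 g00 T0 _ mx _
  ixi xi0 xi2 xz0 alg.
have TR : 0 < T%:R :> R by rewrite ltr0n.
set I := (\int[P]_w _)%E.
pose A := 631 * ((trace_diag beta + g0 * d%:R) * eta ^+ 2 / T%:R).
(* [a ^+ 2] is the coefficient of [lam], and [13 ^+ 2 = 169] dominates 158. The product
   [2 * (a * b)] has constant 52, below 631. *)
pose a := 2 * sigma.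
pose b := 13 * (Num.sqrt d%:R * eta / Num.sqrt T%:R).
have sT : Num.sqrt T%:R ^+ 2 = T%:R :> R by rewrite sqr_sqrtr.
have sd : Num.sqrt d%:R ^+ 2 = d%:R :> R by rewrite sqr_sqrtr.
have b00 : 0 <= b by rewrite mulr_ge0// divr_ge0 ?mulr_ge0 ?sqrtr_ge0// ltW.
have bound lam e : 0 < lam -> 0 < e ->
    (I <= (A + a ^+ 2 * lam + b ^+ 2 / lam + e)%:E)%E.
  move=> lam0 e0; apply: le_trans (expected_err_le Xx0 cX Xeta eta0 b0 coco g00 T0
    mx ixi xi0 xi2 xz0 alg lam0 e0) _.
  rewrite lee_fin lerD2r; apply: lerD; first by rewrite /A /a exprMn; lra.
  rewrite ler_pM2r ?invr_gt0// /b !exprMn exprVn sT sd.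
  have : 0 <= d%:R * eta ^+ 2 / T%:R by rewrite divr_ge0 ?mulr_ge0 ?sqr_ge0// ltW.
  lra.
case: I bound => [i| |] bound; last by rewrite leNye.
  rewrite lee_fin; apply: le_trans (@le_inf_tradeoff _ _ A a b _ b00 _) _.
  - by rewrite mulr_ge0.
  - by move=> lam e lam0 e0; rewrite -lee_fin bound.
  - have Rd0 : 0 <= Rd by rewrite -Rduv sqrtr_ge0.
    have h : 0 <= Num.sqrt d%:R * eta * sigma / Num.sqrt T%:R.
      by rewrite divr_ge0 ?sqrtr_ge0// !mulr_ge0 ?sqrtr_ge0// ltW.
    have h' : 0 <= Rd * sigma / Num.sqrt T%:R.
      by rewrite divr_ge0 ?sqrtr_ge0// mulr_ge0.
    by rewrite /A /a /b; lra.
by have := bound 1 1 ltr01 ltr01; rewrite leye_eq.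
Qed.
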